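(* Let $P$ be a partition of $n$, let $K$ be a field, let $B=J_P$ be the nilpotent $n\times n$ Jordan matrix over $K$ of partition $P$, and let $\mathcal U_B=\{A\in\mathcal N_B\mid \dim_K K[A,B]=n\}$. (A) Suppose $A\in\mathcal U_B$, let $H=H(K[A,B])$, of socle degree $j$, and let $K$ be algebraically closed with $\mathrm{char}\,K=0$ or $\mathrm{char}\,K>j$. Then for generic $\lambda\in\mathbb P^1$ the Jordan block sizes of the action of $A+\lambda B$ (by multiplication) on $K[A,B]$ are given by the parts of $P(H)$. (B) Assume further that $\mathrm{char}\,K=0$ or $\mathrm{char}\,K>n$ (with $K$ algebraically closed). Then the partition $Q(P)$ satisfies $$Q(P)=\max_{A\in\mathcal U_B}P\bigl(H(K[A,B])\bigr),$$ the maximum being taken in the majorization order, and $Q(P)$ has decreasing parts.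
   Context: $J_P$ is the nilpotent matrix in Jordan form with block sizes the parts of $P=(p_1\ge\cdots\ge p_t\ge1)$. $\mathcal N_B$ is the set of nilpotent $n\times n$ matrices over $K$ commuting with $B$; it is an irreducible variety. $Q(P)$ is the partition given by the Jordan block sizes of a generic element of $\mathcal N_B$, $B=J_P$ (every element of some dense open subset). For commuting nilpotent $A,B$, $K[A,B]$ is the $K$-subalgebra of $M_n(K)$ generated by $A,B$ (and the identity), an Artinian local algebra with maximal ideal $\mathfrak m=(A,B)$. Its Hilbert function is $H=(h_0,h_1,\ldots,h_j)$, $h_i=\dim_K \mathfrak m^i/\mathfrak m^{i+1}$, where the socle degree $j$ is the largest $i$ with $h_i\ne0$. Such an $H$ has the form $(1,2,\ldots,\nu,h_\nu,\ldots,h_j)$ with $\nu\ge h_\nu\ge\cdots\ge h_j>0$. $P(H)$ is the partition dual (conjugate) to the partition obtained by rearranging $H$ in non-increasing order, i.e. its $i$-th part is $\#\{k\mid h_k\ge i\}$, $1\le i\le\nu$. ''Generic $\lambda$'' means all but finitely many $\lambda$. The majorization partial order on partitions of $n$ (padded by zeros) is: $P\ge P'$ iff $\sum_{u\le i}p_u\ge\sum_{u\le i}p'_u$ for all $i$. ''Decreasing parts'' means strictly decreasing (pairwise distinct) parts. *)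

(* Defs.v *)
From HB Require Import structures.
From mathcomp Require Import all_boot all_order all_algebra all_field.
From mathcomp Require Import mpoly.

Set Implicit Arguments.
Unset Strict Implicit.
Unset Printing Implicit Defensive.

Import GRing.Theory.
Local Open Scope ring_scope.

Definition is_partition (n : nat) (P : seq nat) : bool :=
  [&& sorted geq P, all (leq 1) P & sumn P == n].

Definition strictly_decreasing (P : seq nat) : bool := sorted gtn P.

(* [take i P] is all of P for i >= size P, which amounts to padding by zeros. *)
Definition majorizes (P P' : seq nat) : Prop :=
  forall i : nat, (sumn (take i P') <= sumn (take i P))%N.

(* The dual of a non-increasing sequence S: its i-th part, 1 <= i <= S_1, is
   the number of parts of S that are at least i. *)
Definition dual_partition (S : seq nat) : seq nat :=
  [seq count (leq i) S | i <- iota 1 (head 0%N S)].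

Definition char_zero_or_gt (K : fieldType) (m : nat) : Prop :=
  [pchar K] =i pred0 \/ exists2 p, p \in [pchar K] & (m < p)%N.

(* For P a partition of n, [reshape_index P i] is the block that contains the
   index i when 0, ..., n-1 is cut into consecutive blocks of sizes P_1, P_2,
   and so on. *)
Definition jordan_nilp (K : fieldType) (n : nat) (P : seq nat) : 'M[K]_n :=
  \matrix_(i, j) ((j == i.+1 :> nat)
                  && (reshape_index P i == reshape_index P j))%:R.

(* f maps the subspace E to itself, and its matrix in some basis e of E is the
   nilpotent Jordan matrix of partition P. *)
Definition has_jordan_type (K : fieldType) (V : vectType K) (E : {vspace V})
    (f : V -> V) (P : seq nat) : Prop :=
  is_partition (\dim E) P /\
  exists2 e : (sumn P).-tuple V, basis_of E e &
    forall j, f (tnth e j) =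
      \sum_i jordan_nilp K (sumn P) P i j *: tnth e i.

Section Commuting.
Variables (K : fieldType) (n : nat).
Implicit Types (A B : 'M[K]_n.+1) (Q : seq nat).

Definition nilpotent_mx A : Prop := exists k : nat, A ^+ k = 0.

Definition nilp_commutator B A : Prop := nilpotent_mx A /\ A * B = B * A.

Definition gen_alg A B : {vspace 'M[K]_n.+1} := agenv <<[:: A; B]>>%VS.

Definition max_ideal A B : {vspace 'M[K]_n.+1} :=
  (gen_alg A B * <<[:: A; B]>>)%VS.

(* The factor [gen_alg A B] only matters for i = 0, where the power of the
   subspace [max_ideal A B] is the line of scalars, whereas the zeroth power
   of the ideal is the whole algebra. *)
Definition max_ideal_pow A B (i : nat) : {vspace 'M[K]_n.+1} :=
  (gen_alg A B * max_ideal A B ^+ i)%VS.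

Definition hilb A B (i : nat) : nat :=
  (\dim (max_ideal_pow A B i) - \dim (max_ideal_pow A B i.+1))%N.

(* For commuting nilpotent A and B of size n.+1 the power n.+1 of the maximal
   ideal is zero, so no index i > n has [hilb A B i != 0]. *)
Definition socle_degree A B : nat :=
  \max_(i < n.+1 | hilb A B i != 0%N) i.

Definition hilbert_seq A B : seq nat :=
  mkseq (hilb A B) (socle_degree A B).+1.

Definition hilbert_partition A B : seq nat :=
  dual_partition (sort geq (hilbert_seq A B)).

Definition full_dim_locus B A : Prop :=
  nilp_commutator B A /\ \dim (gen_alg A B) = n.+1.

(* The projective line is [option K], with [None] the point at infinity, where
   the pencil takes the value B. *)
Definition pencil A B (l : option K) : 'M[K]_n.+1 :=
  if l is Some c then A + c *: B else B.

(* Zariski-open subsets of X, for the topology induced from the affine space of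
   matrices: X minus the common zeros of a set F of polynomials in the
   entries. *)
Definition zariski_open_in (X U : 'M[K]_n.+1 -> Prop) : Prop :=
  exists F : {mpoly K[(n.+1 * n.+1)%N]} -> Prop,
  forall A, U A <-> X A /\ exists2 p, F p & p.@[fun k => mxvec A 0 k] != 0.

Definition zariski_dense_in (X U : 'M[K]_n.+1 -> Prop) : Prop :=
  forall V, zariski_open_in X V -> (exists A, V A) -> exists2 A, V A & U A.

Definition generic_jordan_type B Q : Prop :=
  exists U : 'M[K]_n.+1 -> Prop,
    [/\ zariski_open_in (nilp_commutator B) U,
        zariski_dense_in (nilp_commutator B) U &
        forall A, U A ->
          has_jordan_type {:'cV[K]_n.+1}%VS (fun v => A *m v) Q].

End Commuting.

(* Main.v *)
From HB Require Import structures.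
From mathcomp Require Import mpoly.
Require Import Defs.
From mathcomp Require Import all_boot all_order all_algebra all_field.
From mathcomp Require Import perm zify.
From Stdlib Require Import Classical_Prop.
Local Open Scope ring_scope.

(** Let A and B be commuting nilpotent matrices of size N = n+1 with
dim K[A,B] = N, let m be the maximal ideal of K[A,B] and h its Hilbert
function.

Jordan types are handled through ranks: a nilpotent operator with blocks of
sizes p_u has an i-th power of rank sum_u max(p_u - i, 0) ([jordan_rank]), these
numbers determine the partition, and they order partitions by majorization.

The first half. A form of degree d in A and B is written as a polynomial of
degree at most d by setting B to 1. The forms that fall into m^(d+1) make up
a subspace V_d with h_d + dim V_d = d + 1, and dim V_d increases strictly with
d as soon as it is not 0; so h is 1, 2, ..., nu, and then never increases. For
l = A - mu B, multiples of l^i become multiples of (X - mu)^i. A Wronskian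
argument, the only place where the characteristic matters, shows that for
all but finitely many mu a given subspace V of K[X] contains no nonzero multiple
of (X - mu)^(dim V). Hence l^i is injective or surjective on graded
pieces as far as the dimensions allow. If D is the first degree with D >= i and
dim V_D >= i, then l^i maps m^(D-i) onto m^D and its kernel lies in m^(D-i), so
that

  dim l^i K[A,B] = N - (h_(D-i) + ... + h_(D-1)).

By the shape of h this window consists of i largest values of h, and the
partition dual to h has exactly these ranks ([lefschetz_jordan_rank]). The
shape of h also shows that the parts of the dual partition are distinct.

The second half needs three facts on the set NB of nilpotent matrices that
commute with the nilpotent matrix B.

- Any two A0 and A1 in NB can be joined by a line inside NB, after A1 is
  replaced by a conjugate under the centralizer of B: for each of them B has a
  Jordan basis that makes it strictly triangular modulo the image of B, and the
  matrices that are triangular for one fixed Jordan basis form a linear space of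
  nilpotent matrices ([conjugate_nilpotent_line]). Since rank conditions
  from below are open, the matrices whose powers have the largest possible
  ranks are dense in NB, and a generic Jordan type exists.

- NB contains a matrix S such that the pair (S, B) has a cyclic vector: S
  sends each Jordan block of B onto the next one ([cyclic_partner]). Cyclicity
  is an open condition, so a generic A in NB is cyclic and lies in the generic
  stratum together with A + lambda B for generic lambda; then K[A,B] and K^N
  are isomorphic modules, and by the first half the generic type Q is the dual
  of the Hilbert function of K[A,B].

- By the theorem of Gerstenhaber, two commuting matrices of size r generate an
  algebra of dimension at most r. Applied to the restrictions of A and B to the
  image of l^i, it gives dim l^i K[A,B] <= rank l^i for every A with
  dim K[A,B] = N, cyclic or not ([amull_rank_le]). By semicontinuity rank l^i is
  at most the corresponding rank for Q, which is the majorization. *)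

Set Implicit Arguments.
Unset Strict Implicit.
Unset Printing Implicit Defensive.
Import GRing.Theory.

(** * Partitions and the ranks of powers *)

Section Partitions.
Local Open Scope nat_scope.

(** The rank of the i-th power of a nilpotent operator with Jordan blocks of
sizes P. *)
Definition jordan_rank (P : seq nat) (i : nat) : nat := \sum_(p <- P) (p - i).

Lemma jordan_rank0 P : jordan_rank P 0 = sumn P.
Proof. by rewrite sumnE; apply: eq_bigr => p _; rewrite subn0. Qed.

Lemma sum_seq_const (s : seq nat) c : \sum_(p <- s) c = size s * c.
Proof. by rewrite big_const_seq count_predT iter_addn_0 mulnC. Qed.

Lemma nth_sorted_geq P a b : sorted geq P -> a <= b -> nth 0 P b <= nth 0 P a.
Proof.
move=> sP ab; have [lb|lb] := ltnP b (size P); last by rewrite nth_default.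
have geq_tr : transitive geq by move=> x y z /=; lia.
by apply: (sorted_leq_nth geq_tr leqnn 0 sP); rewrite ?inE //; lia.
Qed.

(** With c the (k+1)-st part of P, or 0, the sum of the k largest parts of P is
[jordan_rank P c + k * c], while for any P' this expression is an upper bound
for the sum of k parts. *)
Lemma majorizes_of_jordan_rank P P' : sorted geq P ->
  (forall i, jordan_rank P' i <= jordan_rank P i) -> majorizes P P'.
Proof.
move=> sP le k; set c := nth 0 P k.
have le1 : sumn (take k P') <= jordan_rank P' c + k * c.
  rewrite sumnE /jordan_rank -{2}(cat_take_drop k P') big_cat /=.
  have: \sum_(p <- take k P') p <= \sum_(p <- take k P') ((p - c) + c).
    by apply: leq_sum => p _; lia.
  rewrite big_split /= sum_seq_const => le2.
  by apply: leq_trans le2 _; rewrite size_take_min; nia.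
apply: leq_trans le1 _; apply: (leq_trans (leq_add (le c) (leqnn _))).
rewrite sumnE /jordan_rank -{1}(cat_take_drop k P) big_cat /=.
have -> : \sum_(p <- drop k P) (p - c) = 0.
  rewrite big_seq big1 // => p /(nthP 0) [m]; rewrite size_drop nth_drop => lm <-.
  apply/eqP; rewrite subn_eq0.
  by apply: nth_sorted_geq => //; lia.
have [lk|lk] := ltnP k (size P); last first.
  rewrite /c (nth_default _ lk) muln0 !addn0; apply: leq_sum => p _; lia.
have -> : k * c = \sum_(p <- take k P) c.
  by rewrite sum_seq_const size_take_min; congr (_ * _); lia.
rewrite addn0 -big_split /= big_seq [leqRHS]big_seq; apply: leq_sum => p.
move=> /(nthP 0) [m]; rewrite size_take_min => lm <-; rewrite nth_take; last by lia.
rewrite subnK //.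
by apply: nth_sorted_geq => //; lia.
Qed.

Lemma jordan_rank_inj n P P' : is_partition n P -> is_partition n P' ->
  jordan_rank P =1 jordan_rank P' -> P = P'.
Proof.
move=> /and3P[sP aP _] /and3P[sP' aP' _] e.
have m1 : majorizes P P' by apply: majorizes_of_jordan_rank => // i; rewrite e.
have m2 : majorizes P' P by apply: majorizes_of_jordan_rank => // i; rewrite e.
have eS k : sumn (take k P) = sumn (take k P').
  by apply/eqP; rewrite eqn_leq m1 m2.
have sumnS s k : sumn (take k.+1 s) = sumn (take k s) + nth 0 s k.
  have [lk|lk] := ltnP k (size s); first by rewrite (take_nth 0) // sumn_rcons.
  by rewrite nth_default // !take_oversize //; lia.
have eN k : nth 0 P k = nth 0 P' k by have:= eS k.+1; rewrite !sumnS eS; lia.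
have pos s k : all (leq 1) s -> (0 < nth 0 s k) = (k < size s).
  move=> /allP as_; have [lk|lk] := ltnP k (size s); last by rewrite nth_default.
  by apply: as_; apply: mem_nth.
apply: (@eq_from_nth _ 0) => // .
have := pos _ (size P') aP; have := pos _ (size P) aP'.
by rewrite -(eN (size P)) (eN (size P')) !nth_default //; lia.
Qed.

Lemma sum_indicator_leq m n : n <= m -> \sum_(1 <= u < m.+1) (u <= n : nat) = n.
Proof.
move=> le; rewrite big_mkcond_idem //= (@big_cat_nat _ _ _ n.+1) //=; try lia.
rewrite [X in _ + X]big_nat [X in _ + X]big1 ?addn0; last by move=> u /andP[lu _]; rewrite leqNgt lu.
rewrite big_nat (eq_bigr (fun=> 1)); last by move=> u /andP[_ lu]; rewrite -ltnS lu.
by rewrite -big_nat sum_nat_const_nat; lia.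
Qed.

Section Dual.
Variables (h : nat -> nat) (L : nat).
Hypothesis hL : forall d, L <= d -> h d = 0.
Let H := mkseq h L.
Let m := head 0 (sort geq H).
Let P := dual_partition (sort geq H).

Lemma head_sort_geq d : h d <= m.
Proof.
have [ld|ld] := ltnP d L; last by rewrite hL.
have geq_total : total geq by move=> x y /=; lia.
have geq_tr : transitive geq by move=> x y z /=; lia.
have : h d \in sort geq H by rewrite mem_sort; apply/mapP; exists d; rewrite ?mem_iota.
rewrite /m; case E: (sort geq H) => [|x s] //=; rewrite inE => /orP[/eqP->//|hs].
have := sort_sorted geq_total H; rewrite E /= (path_sortedE geq_tr).
by case/andP => /allP /(_ _ hs).
Qed.

Lemma dual_partitionE :
  P = [seq \sum_(0 <= d < L) (u <= h d : nat) | u <- iota 1 m].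
Proof.
apply/eq_in_map => u _; rewrite count_sort count_map -sum1_count.
by rewrite /index_iota subn0 [LHS]big_mkcond /=; apply: eq_bigr => d _ /=; case: leqP.
Qed.

(** Let the i = b - a indices of the window [a, b[ carry i largest values
of h, separated from the other values by a threshold c. For u <= c the part
counting the values >= u counts all of the window, for u > c it counts nothing
outside of it; so subtracting i from each part removes exactly the window. *)
Lemma jordan_rank_dual a b c : a <= b ->
  (forall d, a <= d < b -> c <= h d) ->
  (forall d, ~~ (a <= d < b) -> h d <= c) ->
  jordan_rank P (b - a) + \sum_(a <= d < b) h d = \sum_(0 <= d < L) h d.
Proof.
move=> ab hin hout; pose M := maxn b L.
have extend (F : nat -> nat) : (forall d, L <= d -> F d = 0) ->
    \sum_(0 <= d < L) F d = \sum_(0 <= d < M) F d.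
  move=> F0; rewrite [RHS](@big_cat_nat _ _ _ L) //=; last by rewrite /M; lia.
  by rewrite [X in _ = _ + X]big_nat [X in _ = _ + X]big1 ?addn0 // => d /andP[/F0].
have split (F : nat -> nat) : \sum_(0 <= d < M) F d
    = \sum_(a <= d < b) F d + \sum_(0 <= d < M | ~~ (a <= d < b)) F d.
  rewrite (bigID (fun d => a <= d < b)) /=; congr (_ + _).
  rewrite [RHS](big_nat_widen _ _ M) ?leq_maxl // [RHS](big_nat_widenl _ 0) //=.
  by apply: eq_bigl => d; rewrite andbC.
have -> : jordan_rank P (b - a) = \sum_(0 <= d < M | ~~ (a <= d < b)) h d.
  rewrite /jordan_rank dual_partitionE big_map.
  have -> : iota 1 m = index_iota 1 m.+1 by rewrite /index_iota subn1.
  rewrite big_nat (eq_bigr (fun u =>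
     \sum_(0 <= d < M | ~~ (a <= d < b)) (u <= h d : nat))); last first.
    move=> u /andP[u0 _]; rewrite extend; last by move=> d /hL->; lia.
    rewrite split; set X := \sum_(0 <= d < M | _) _.
    have [uc|cu] := leqP u c.
      rewrite big_nat (eq_bigr (fun=> 1)); last by move=> d /hin; lia.
      by rewrite -big_nat sum_nat_const_nat; lia.
    have -> : X = 0 by rewrite /X big1 // => d /hout; lia.
    have : \sum_(a <= d < b) (u <= h d : nat) <= \sum_(a <= d < b) 1.
      by apply: leq_sum => d _; exact: leq_b1.
    by rewrite sum_nat_const_nat; lia.
  rewrite -big_nat exchange_big /=; apply: eq_bigr => d _.
  exact/sum_indicator_leq/head_sort_geq.
by rewrite addnC -split -extend.
Qed.

Lemma is_partition_dual : is_partition (\sum_(0 <= d < L) h d) P.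
Proof.
apply/and3P; split.
- rewrite dual_partitionE sorted_map; apply/(sortedP 0) => u.
  rewrite size_iota => lu; rewrite !nth_iota //=; last by lia.
  by apply: leq_sum => d _; lia.
- rewrite dual_partitionE all_map; apply/allP => u; rewrite mem_iota /= => lu.
  have : m \in sort geq H.
    by move: lu; rewrite /m; case: (sort geq H) => [|x s] /=; [lia | rewrite inE eqxx].
  rewrite mem_sort => /mapP[d]; rewrite mem_iota => ld em.
  rewrite (big_cat_nat _ (n := d)) //=; last by lia.
  by rewrite [X in _ + X]big_ltn -?em //; lia.
- rewrite -jordan_rank0; apply/eqP.
  rewrite -(@jordan_rank_dual 0 0 m) // ?subn0 //; last first.
    by move=> d _; exact: head_sort_geq.
  by rewrite [X in _ + X]big_geq ?addn0.
Qed.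

(** Two consecutive parts differ by the number of indices at which h takes
a given value. *)
Lemma strictly_decreasing_dual :
  (forall u, 0 < u <= m -> u \in H) -> strictly_decreasing P.
Proof.
move=> hu; rewrite /strictly_decreasing dual_partitionE sorted_map.
apply/(sortedP 0) => u; rewrite size_iota => lu; rewrite !nth_iota //=; try lia.
have /hu : 0 < u.+1 <= m by lia.
case/mapP => d; rewrite mem_iota => ld hd.
rewrite (big_cat_nat _ (n := d)) //=; try lia.
rewrite [X in _ < X](big_cat_nat _ (n := d)) //=; try lia.
rewrite [X in _ + X < _]big_ltn ?[X in _ < _ + X]big_ltn; try lia.
have le_sum a b : \sum_(a <= i < b) (u.+2 <= h i : nat)
    <= \sum_(a <= i < b) (u.+1 <= h i : nat).
  by apply: leq_sum => i _; have := @ltnW u.+1 (h i); case: (u.+1 < h i) => // ->.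
rewrite -hd !add1n ltnn leqnn /= add0n -addnS.
by apply: leq_add; rewrite ?ltnS; apply: le_sum.
Qed.

End Dual.
End Partitions.

(** * Generic scalars *)

(** Cofiniteness in the form in which it multiplies: outside of the roots of
some nonzero polynomial. *)
Definition generically (K : fieldType) (Q : K -> Prop) : Prop :=
  exists2 W : {poly K}, W != 0 & forall l, W.[l] != 0 -> Q l.

Section Generically.
Variable K : fieldType.
Implicit Types (Q R : K -> Prop).

Lemma generically_imp Q R : (forall l, Q l -> R l) -> generically Q -> generically R.
Proof. by move=> QR [W W0 WQ]; exists W => // l /WQ/QR. Qed.

Lemma generically_true Q : (forall l, Q l) -> generically Q.
Proof. by move=> hQ; exists 1; rewrite ?oner_neq0. Qed.

Lemma generically_and Q R :
  generically Q -> generically R -> generically (fun l => Q l /\ R l).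
Proof.
move=> [W W0 WQ] [X X0 XR]; exists (W * X); first by rewrite mulf_neq0.
by move=> l; rewrite hornerM mulf_eq0 negb_or => /andP[/WQ ? /XR].
Qed.

Lemma generically_all (I : eqType) (s : seq I) (Q : I -> K -> Prop) :
  (forall x, x \in s -> generically (Q x)) ->
  generically (fun l => forall x, x \in s -> Q x l).
Proof.
elim: s => [|x s IH] h; first exact: generically_true.
have hx := h x (mem_head _ _).
have {}IH := IH (fun y hy => h y (mem_behead (s := x :: s) hy)).
apply: generically_imp (generically_and hx IH) => l [Qx Qs] y.
by rewrite inE => /orP[/eqP->|/Qs].
Qed.

End Generically.

Section ClosedField.
Variable K : fieldType.
Hypothesis clK : GRing.closed_field_axiom K.
Implicit Types (p W : {poly K}) (Q : K -> Prop).

Lemma closed_field_root p : (1 < size p)%N -> exists x, root p x.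
Proof.
move=> sp; have p0 : p != 0 by rewrite -size_poly_gt0; apply: ltnW.
have es : size p = (size p).-1.+1 by rewrite prednK // ltnW.
have [|x ex] := clK (n := (size p).-1) (fun i => - p`_i / lead_coef p).
  by rewrite -ltnS -es.
exists x; rewrite /root horner_coef es big_ord_recr /= ex mulr_sumr.
rewrite -big_split /= big1 // => i _.
rewrite -/(lead_coef p) [lead_coef p * _]mulrA [lead_coef p * _]mulrC.
by rewrite divfK ?lead_coef_eq0 // mulNr subrr.
Qed.

Lemma closed_field_roots p : p != 0 -> exists s : seq K, forall x, root p x -> x \in s.
Proof.
have [m] := ubnP (size p); elim: m => // m IH in p *; rewrite ltnS => sp p0.
have [s1|s1] := leqP (size p) 1.
  exists [::] => x; move: s1 p0 => /size1_polyC ->.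
  by rewrite polyC_eq0 /root hornerC => /negbTE->.
have [a] := closed_field_root s1; move/factor_theorem => [q eq_p].
have q0 : q != 0 by apply: contraNneq p0 => q0; rewrite eq_p q0 mul0r.
have [|s hs] := IH q _ q0.
  by apply: leq_trans sp; rewrite eq_p size_Mmonic ?monicXsubC // size_XsubC addn2.
exists (a :: s) => x; rewrite eq_p rootM root_XsubC inE => /orP[/hs->|/eqP->].
  by rewrite orbT.
by rewrite eqxx.
Qed.

(** An algebraically closed field is infinite. *)
Lemma generically_ex Q : generically Q -> exists l, Q l.
Proof.
move=> [W W0 hW].
(* a root l of W X + 1 satisfies l W(l) = -1 *)
have [|l] := @closed_field_root (W * 'X + 1%:P).
  by rewrite size_MXaddC (negbTE W0) ltnS size_poly_gt0.
rewrite /root !hornerE => /eqP e; exists l; apply: hW.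
by apply: contra_eq_neq e => ->; rewrite mul0r add0r oner_neq0.
Qed.

Lemma generically_cofinite Q : generically Q -> exists s : seq K, forall l, l \notin s -> Q l.
Proof.
move=> [W W0 hW]; have [s hs] := closed_field_roots W0.
exists s => l ls; apply: hW; apply: contraNneq ls => /eqP; exact: hs.
Qed.

End ClosedField.

(** * Subspaces of polynomials and their contact with a generic point *)

(** This is how the characteristic enters: the possible degrees of the
polynomials at hand stay distinct in K. *)
Lemma natr_neq_of_char (K : fieldType) (m a b : nat) :
  char_zero_or_gt K m -> (a <= m)%N -> (b <= m)%N -> a != b ->
  a%:R != b%:R :> K.
Proof.
move=> hK; wlog ab : a b / (a < b)%N => [IH am bm ne|am bm _].
  have /orP[lt|lt] : (a < b)%N || (b < a)%N by lia.
    exact: IH.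
  by rewrite eq_sym; apply: IH => //; rewrite eq_sym.
rewrite eq_sym -subr_eq0 -natrB; last exact: ltnW.
case: hK => [c0|[p cp lp]].
  have/pcharf0P-> := c0; lia.
by rewrite -(dvdn_pcharf cp) gtnNdvd //; lia.
Qed.

Section Wronskian.
Variable K : fieldType.
Implicit Types (p q : {poly K}).

(** The i-th power of the derivation X d/dX. It multiplies the coefficient of
degree k by k^i, which turns the leading coefficients of a Wronskian into a
Vandermonde matrix. *)
Definition euler_op (i : nat) p : {poly K} := iter i (fun q => 'X * q^`()) p.

Lemma coef_euler_op i p k : (euler_op i p)`_k = k%:R ^+ i * p`_k.
Proof.
elim: i k => [|i IH] k /=; first by rewrite mul1r.
rewrite coefXM coef_deriv IH; case: k => [|k] /=.
  by rewrite expr0n /= !mul0r.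
by rewrite exprS -mulrA mulr_natl.
Qed.

Lemma euler_op_is_linear i : linear (euler_op i).
Proof.
move=> c p q; apply/polyP => k.
by rewrite coefD coefZ !coef_euler_op coefD coefZ mulrDr mulrCA.
Qed.

HB.instance Definition _ i :=
  GRing.isLinear.Build K {poly K} {poly K} _ (euler_op i) (euler_op_is_linear i).

Lemma horner_euler_op_eq0 (l : K) r i p :
  ('X - l%:P) ^+ r %| p -> (i < r)%N -> (euler_op i p).[l] = 0.
Proof.
move=> dv ir; suff: ('X - l%:P) ^+ (r - i) %| euler_op i p.
  case/dvdpP => q ->; rewrite hornerM horner_exp !hornerE subrr.
  by rewrite expr0n /= (_ : (r - i == 0)%N = false) ?mulr0 //; lia.
elim: i ir => [|i IH] ir; first by rewrite subn0.
have /dvdpP[q e] := IH (ltnW ir).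
rewrite /euler_op /= -/(euler_op i p) e derivM deriv_exp derivXsubC -mulrnAr.
have -> : (r - i)%N = (r - i.+1).+1 by lia.
rewrite /= exprS mul1r; apply: dvdp_mull; apply: dvdp_add.
  by apply/dvdp_mull/dvdp_mull.
by rewrite mulrnAr -mulrnAl; apply/dvdp_mull.
Qed.

(** Top coefficients multiply even if some of the degree bounds are not
attained, so that a determinant can be expanded in top coefficients. *)
Lemma coef_prod_top (I : Type) (s : seq I) (F : I -> {poly K}) (a : I -> nat) :
  (forall i, size (F i) <= (a i).+1)%N ->
  (\prod_(i <- s) F i)`_(\sum_(i <- s) a i)%N = \prod_(i <- s) (F i)`_(a i).
Proof.
move=> sz; suff [//] : (\prod_(i <- s) F i)`_(\sum_(i <- s) a i)%N =
   \prod_(i <- s) (F i)`_(a i) /\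
   (size (\prod_(i <- s) F i)%R <= (\sum_(i <- s) a i).+1)%N.
elim: s => [|i s [IH1 IH2]]; first by rewrite !big_nil coef1 size_poly1.
rewrite !big_cons; split.
  rewrite coefM (bigD1 (inord (a i))) //= inordK ?ltnS ?leq_addr // addKn IH1.
  rewrite [X in _ + X]big1 ?addr0 // => j; rewrite -val_eqE /= inordK ?ltnS ?leq_addr //.
  move=> ne; have [lt|le] := ltnP j (a i).
    by rewrite [X in _ * X]nth_default ?mulr0 //; apply: leq_trans IH2 _; lia.
  rewrite [X in X * _]nth_default ?mul0r //.
  by apply: leq_trans (sz i) _; lia.
apply: (leq_trans (size_polyMleq _ _)); have := sz i; lia.
Qed.

(** A subspace of K[X] of dimension r has r monic elements of distinct
degrees: split off an element of the largest degree and pass to the hyperplane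
of the elements of smaller degree. *)
Lemma distinct_degree_family m (V : {vspace 'rV[K]_m}) :
  exists f : nat -> 'rV[K]_m, exists a : nat -> nat,
  [/\ forall i, (i < \dim V)%N -> f i \in V,
      forall i, (i < \dim V)%N -> (a i < m)%N,
      forall i j, (i < j < \dim V)%N -> (a i < a j)%N &
      forall i, (i < \dim V)%N -> (rVpoly (f i))`_(a i) = 1
         /\ (size (rVpoly (f i)) <= (a i).+1)%N].
Proof.
suff H s : (s <= m)%N -> forall V : {vspace 'rV[K]_m},
    (forall v, v \in V -> (size (rVpoly v) <= s)%N) ->
  exists f : nat -> 'rV[K]_m, exists a : nat -> nat,
  [/\ forall i, (i < \dim V)%N -> f i \in V,
      forall i, (i < \dim V)%N -> (a i < s)%N,
      forall i j, (i < j < \dim V)%N -> (a i < a j)%N &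
      forall i, (i < \dim V)%N -> (rVpoly (f i))`_(a i) = 1
         /\ (size (rVpoly (f i)) <= (a i).+1)%N].
  by apply: (H m) => // v _; apply: size_poly.
elim: s => [|s IH] ls {}V sV.
  have -> : V = 0%VS.
    apply/eqP; rewrite -subv0; apply/subvP => v /sV; rewrite leqn0 size_poly_eq0.
    by rewrite memv0 => /eqP e; rewrite -[v]rVpolyK e linear0.
  by exists (fun=> 0), (fun=> 0%N); rewrite dimv0; split=> // i j; rewrite ltn0 andbF.
pose phi : 'Hom('rV[K]_m, 'rV[K]_1) := linfun (mulmxr (delta_mx (Ordinal ls) 0)).
have phi_eq0 v : (phi v == 0) = ((rVpoly v)`_s == 0).
  have -> : (rVpoly v)`_s = phi v 0 0.
    by rewrite lfunE /= -colE mxE -coef_rVpoly_ord.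
  apply/eqP/eqP => [->|e]; first by rewrite mxE.
  by apply/rowP => j; rewrite ord1 e mxE.
have sz1 v : (size (rVpoly v) <= s.+1)%N -> phi v = 0 -> (size (rVpoly v) <= s)%N.
  move=> /leq_sizeP h0 /eqP; rewrite phi_eq0 => /eqP h1; apply/leq_sizeP => j.
  by rewrite leq_eqVlt => /orP[/eqP<-|/h0].
have [V0|] := boolP (V <= lker phi)%VS.
  have [|f [a [h1 h2 h3 h4]]] := IH (ltnW ls) V.
    by move=> v vV; apply: sz1; [apply: sV | apply/eqP; rewrite -memv_ker (subvP V0)].
  by exists f, a; split => // i /h2; lia.
case/subvPn => v vV; rewrite memv_ker => nv.
pose V1 := (V :&: lker phi)%VS.
have dV : \dim V = (\dim V1).+1.
  suff d1 : \dim (phi @: V) = 1%N by rewrite -(limg_ker_dim phi V) d1 addn1.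
  apply/eqP; rewrite eqn_leq; apply/andP; split.
    by apply: leq_trans (dimvS (subvf _)) _; rewrite dimvf dim_matrix.
  rewrite lt0n dimv_eq0; apply/eqP => e0.
  by have := memv_img phi vV; rewrite e0 memv0 (negbTE nv).
have [|f [a [h1 h2 h3 h4]]] := IH (ltnW ls) V1.
  move=> u /memv_capP[uV uk]; apply: sz1; [exact: sV|].
  by apply/eqP; rewrite -memv_ker.
rewrite dV; exists (fun i => if (i < \dim V1)%N then f i else ((rVpoly v)`_s)^-1 *: v).
exists (fun i => if (i < \dim V1)%N then a i else s); split.
- move=> i _; case: ifP => [/h1/memv_capP[]//|_]; exact: memvZ.
- move=> i _; case: ifP => [/h2|]; lia.
- move=> i j; rewrite ltnS => /andP[lij lj].
  have li := leq_trans lij lj; rewrite li.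
  by case: ifP => lj'; [apply: h3; rewrite lij | apply: h2].
- move=> i _; case: ifP => [/h4//|_]; rewrite linearZ /= coefZ mulVf -?phi_eq0 //.
  split=> //; apply: leq_trans (size_scale_leq _ _) _; exact: sV.
Qed.

(** The exceptional scalars are roots of the Wronskian of the family of the
preceding lemma. This determinant is not zero, since its coefficient in degree
the sum of the degrees is the Vandermonde determinant of these degrees. *)
Lemma generic_nonosculating m (V : {vspace 'rV[K]_m}) :
  char_zero_or_gt K m.-1 ->
  generically (fun l => forall v, v \in V ->
    ('X - l%:P) ^+ \dim V %| rVpoly v -> v = 0).
Proof.
move=> hK; have [f [a [fV am aS fa]]] := distinct_degree_family V.
set r := \dim V in fV am aS fa *.
pose M : 'M[{poly K}]_r := \matrix_(j, i) euler_op i (rVpoly (f j)).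
have szM j i : (size (M j i) <= (a j).+1)%N.
  apply/leq_sizeP => k lk; rewrite mxE coef_euler_op nth_default ?mulr0 //.
  by case: (fa j (ltn_ord j)) => _ sz; apply: leq_trans sz lk.
exists (\det M).
  apply/eqP => e0; have := congr1 (fun p => p`_(\sum_(j < r) a j)%N) e0.
  rewrite coef0 coef_sum.
  have -> : \sum_(s : 'S_r) ((-1) ^+ s * \prod_(i < r) M i (s i))`_(\sum_(j < r) a j)%N
    = \det (Vandermonde r (\row_(j < r) (a j)%:R : 'rV[K]_r))^T.
    apply: eq_bigr => s _; rewrite !mulr_sign.
    have -> : \prod_i (Vandermonde r (\row_(j < r) (a j)%:R : 'rV[K]_r))^T i (s i)
       = (\prod_(i < r) M i (s i))`_(\sum_(j < r) a j)%N.
      rewrite coef_prod_top //; apply: eq_bigr => j _; rewrite !mxE coef_euler_op.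
      by case: (fa j (ltn_ord j)) => -> _; rewrite mulr1.
    by case: ifP => _; rewrite ?coefN.
  rewrite det_tr det_Vandermonde => /eqP; apply/negP.
  apply/prodf_neq0 => i _; apply/prodf_neq0 => j ij; rewrite !mxE subr_eq0.
  have := am i (ltn_ord i); have := am j (ltn_ord j); have := aS i j.
  rewrite ij ltn_ord => /(_ isT) ? ? ?.
  by apply: (natr_neq_of_char hK); lia.
move=> l Wl.
(* the Wronski matrix at l is invertible; apply it to the coordinates *)
have key (c : 'I_r -> K) :
    ('X - l%:P) ^+ r %| rVpoly (\sum_j c j *: f j) -> forall j, c j = 0.
  move=> dv; pose Ml := map_mx (horner_eval l) M.
  have uM : Ml \in unitmx by rewrite unitmxE det_map_mx unitfE.
  have c0 : (\row_j c j) *m Ml = 0.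
    apply/rowP => i; rewrite !mxE -[RHS](horner_euler_op_eq0 dv (ltn_ord i)).
    rewrite !linear_sum /= horner_sum; apply: eq_bigr => j _; rewrite !mxE.
    by rewrite !linearZ /= hornerZ.
  move=> j; have := congr1 (fun u => (u *m invmx Ml) 0 j) c0.
  by rewrite mulmxK // mul0mx !mxE.
pose F := [tuple f j | j < r].
have FE (j : 'I_r) : F`_j = f j by rewrite -tnth_nth tnth_mktuple.
have F_basis : basis_of V F.
  rewrite basisEfree size_tuple leqnn andbT; apply/andP; split; last first.
    by apply/span_subvP => u /mapP[j _ ->]; apply: fV.
  apply/freeP => c c0; apply: key; rewrite -[X in rVpoly X](_ : 0 = _) ?linear0 ?dvdp0 //.
  by rewrite -[LHS]c0; apply: eq_bigr => j _; rewrite FE.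
move=> v vV; rewrite (coord_basis F_basis vV).
rewrite (eq_bigr (fun j => coord F j v *: f j)) => [/key c0|j _]; last by rewrite FE.
by rewrite big1 // => j _; rewrite c0 scale0r.
Qed.

End Wronskian.

(** A subspace of V of dimension i contains no nonzero multiple of
(X - l)^i, hence by dimension it is a complement of the space of these
multiples. *)
Lemma generic_osculating_complement (K : fieldType) m (V : {vspace 'rV[K]_m}) i :
  char_zero_or_gt K m.-1 -> (i <= \dim V)%N ->
  generically (fun l => forall v, exists2 u, u \in V & ('X - l%:P) ^+ i %| rVpoly (v - u)).
Proof.
move=> hK iV; pose V' := <<take i (vbasis V)>>%VS.
have dV' : \dim V' = i.
  have fr : free (take i (vbasis V)).
    have := basis_free (vbasisP V); rewrite -{1}(cat_take_drop i (vbasis V)).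
    exact: catl_free.
  by rewrite (eqP fr) size_take size_tuple; case: ltnP => //; lia.
have sV' : (V' <= V)%VS.
  by apply/span_subvP => x /mem_take; apply: vbasis_mem.
have im : (i <= m)%N.
  by apply: leq_trans iV _; apply: leq_trans (dimvS (subvf V)) _; rewrite dimvf dim_matrix mul1r.
have [W W0 hW] := generic_nonosculating V' hK.
exists W => // l /hW {}hW v; rewrite dV' in hW.
pose mu : 'Hom('rV[K]_(m - i), 'rV[K]_m) :=
  linfun (poly_rV \o ((('X - l%:P) ^+ i) \*o rVpoly)).
have muE w : rVpoly (mu w) = ('X - l%:P) ^+ i * rVpoly w.
  rewrite lfunE /= poly_rV_K //; apply: leq_trans (size_polyMleq _ _) _.
  have := size_poly (m - i) (fun k => if insub k is Some j then w 0 j else 0).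
  by rewrite -/(rVpoly w) size_exp_XsubC addSn /= => sz; rewrite -leq_subRL.
have mu_inj : lker mu == 0%VS.
  apply/lker0P => u w /(congr1 rVpoly); rewrite !muE.
  move=> /(mulfI (expf_neq0 _ (negbT (polyXsubC_eq0 _)))).
  exact: (can_inj rVpolyK).
have d_mu : \dim (limg mu) = (m - i)%N.
  by rewrite limg_dim_eq ?(eqP mu_inj) ?capv0 // dimvf dim_matrix mul1r.
have cap0 : (V' :&: limg mu = 0)%VS.
  apply/eqP; rewrite -subv0; apply/subvP => u /memv_capP[uV' /memv_imgP[w _ e]].
  rewrite memv0; apply/eqP; apply: hW => //; rewrite e muE; exact: dvdp_mulr.
have full : (V' + limg mu)%VS = fullv.
  apply/eqP; rewrite eqEdim subvf /= dimv_disjoint_sum // dV' d_mu.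
  by rewrite dimvf dim_matrix mul1r subnKC.
have := memvf v; rewrite -full => /memv_addP[u uV' [_ /memv_imgP[w _ ->] ->]].
exists u; first exact: (subvP sV').
by rewrite (addrC u) addrK muE dvdp_mulr.
Qed.

(** * Binary forms and the powers of the maximal ideal *)

Section Form.
Variables (K : fieldType) (n : nat) (A B : 'M[K]_n.+1).
Implicit Types (p q : {poly K}) (d i : nat).

(** The form sum_k p_k x^k y^(d-k) evaluated at (A, B). *)
Definition binary_form d p : 'M[K]_n.+1 :=
  \sum_(k < d.+1) p`_k *: (A ^+ k * B ^+ (d - k)).

Lemma form_is_linear d : linear (binary_form d).
Proof.
move=> c p q; rewrite /binary_form scaler_sumr -big_split /=; apply: eq_bigr => k _.
by rewrite coefD coefZ scalerDl scalerA.
Qed.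

HB.instance Definition _ d :=
  GRing.isLinear.Build K {poly K} 'M[K]_n.+1 _ (binary_form d) (form_is_linear d).

Hypothesis AB : A * B = B * A.

Lemma form_mulX d p : binary_form d.+1 ('X * p) = A * binary_form d p.
Proof.
rewrite /binary_form big_ord_recl /= coefXM scale0r add0r mulr_sumr.
apply: eq_bigr => k _; rewrite coefXM /= -scalerAr mulrA -exprS.
by congr (_ *: (_ * _ ^+ _)); rewrite /bump /=; lia.
Qed.

Lemma form_succ d p : (size p <= d.+1)%N -> binary_form d.+1 p = B * binary_form d p.
Proof.
move=> sz; rewrite /binary_form big_ord_recr /= nth_default // scale0r addr0 mulr_sumr.
apply: eq_bigr => k _; rewrite -scalerAr mulrA; have cBA: GRing.comm B A by rewrite /GRing.comm AB.
rewrite (commrX k cBA) -mulrA -exprS subSn //.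
by have := ltn_ord k; lia.
Qed.

(** Multiplication by powers of a linear form becomes multiplication of
polynomials, which brings the contact of subspaces of K[X] with a point into
play. *)
Lemma form_pencil (l : K) d i p : (size p <= d.+1)%N ->
  binary_form (d + i) (('X - l%:P) ^+ i * p) = (A - l *: B) ^+ i * binary_form d p.
Proof.
move=> sz; elim: i => [|i IH]; first by rewrite addn0 !mul1r.
have sz' : (size (('X - l%:P) ^+ i * p)%R <= (d + i).+1)%N.
  apply: leq_trans (size_polyMleq _ _) _; by rewrite size_exp_XsubC addSn /= addnC -addSn leq_add2r.
rewrite addnS !exprS -!mulrA -IH !mulrBl linearB /= form_mulX; congr (_ - _).
by rewrite mul_polyC linearZ /= form_succ // scalerAl.
Qed.

End Form.

Section Filtration.
Variables (K : fieldType) (n : nat) (A B : 'M[K]_n.+1).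
Hypothesis AB : A * B = B * A.

Let G := gen_alg A B.
Let W : {vspace 'M[K]_n.+1} := <<[:: A; B]>>%VS.
Let J d := max_ideal_pow A B d.

Lemma gen_alg_central : (G <= 'C(G))%VS.
Proof.
have sub (U V : {vspace 'M[K]_n.+1}) : (U <= 'C(V) -> agenv U <= 'C(V))%VS.
  move=> UV; apply: agenv_sub_modl.
    by rewrite -memvE centv1.
  by apply/prodvP => u v /(subvP UV) hu hv; apply: memvM.
apply: (sub); rewrite centvC; apply: (sub).
apply/span_subvP => x; rewrite -subv_cent1 => hx; apply/span_subvP => y.
by move: hx; rewrite !inE => /orP[]/eqP-> /orP[]/eqP->; apply/cent1vP.
Qed.

Lemma gen_algC : {in G &, commutative *%R}.
Proof. exact/centvsP/gen_alg_central. Qed.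

Lemma memv_A : A \in G.
Proof. by apply: (subvP (sub_agenv _)); apply: memv_span; rewrite inE eqxx. Qed.
Lemma memv_B : B \in G.
Proof. by apply: (subvP (sub_agenv _)); apply: memv_span; rewrite !inE eqxx orbT. Qed.

Lemma prodvC_in (U V : {vspace 'M[K]_n.+1}) :
  (U <= G -> V <= G -> U * V = V * U)%VS.
Proof.
have half (U1 V1 : {vspace 'M[K]_n.+1}) :
    (U1 <= G -> V1 <= G -> U1 * V1 <= V1 * U1)%VS.
  move=> /subvP UG /subvP VG; apply/prodvP => u v hu hv.
  by rewrite (gen_algC (UG _ hu) (VG _ hv)) memv_mul.
by move=> UG VG; apply/eqP; rewrite eqEsubv !half.
Qed.

Lemma subX_gen d : (W ^+ d <= G)%VS. Proof. exact: subX_agenv. Qed.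

(** By commutativity the power of the ideal is generated by the monomials of
degree d in A and B. *)
Lemma max_ideal_powE d : J d = (G * W ^+ d)%VS.
Proof.
rewrite /J /max_ideal_pow -/G; elim: d => [|d IH]; first by rewrite !expv0.
rewrite expvSr prodvA IH [in RHS]expvSr [RHS]prodvA /max_ideal -/G -/W [LHS]prodvA.
congr (_ * _)%VS.
by rewrite -prodvA (prodvC_in (subX_gen d)) ?subvv // prodvA agenvM.
Qed.

Lemma max_ideal_pow0 : J 0 = G.
Proof. by rewrite max_ideal_powE expv0 prodv1. Qed.

Lemma max_ideal_pow_rec d : J d = (W ^+ d + J d.+1)%VS.
Proof.
by rewrite !max_ideal_powE expvSl {1}/G /gen_alg agenvEr prodvDl prod1v -prodvA.
Qed.

Lemma max_ideal_pow_le d e : (d <= e)%N -> (J e <= J d)%VS.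
Proof.
move=> /subnKC <-; elim: (e - d)%N => [|k IH]; first by rewrite addn0 subvv.
by rewrite addnS; apply: subv_trans _ IH; rewrite [X in (_ <= X)%VS]max_ideal_pow_rec addvSr.
Qed.

Lemma max_ideal_pow_sub d : (J d <= G)%VS.
Proof. by rewrite -max_ideal_pow0 max_ideal_pow_le. Qed.

Lemma max_ideal_pow_mul d e x y : x \in J d -> y \in J e -> x * y \in J (d + e)%N.
Proof.
rewrite !max_ideal_powE => hx hy; have := memv_mul hx hy.
rewrite -prodvA [X in (_ * X)%VS]prodvA (prodvC_in (subX_gen d)) ?subvv //.
by rewrite -prodvA prodvA agenvM -expvD.
Qed.

Definition form_lin d : 'Hom('rV[K]_d.+1, 'M[K]_n.+1) :=
  linfun (binary_form A B d \o rVpoly).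

Lemma form_linE d v : form_lin d v = binary_form A B d (rVpoly v).
Proof. by rewrite lfunE. Qed.

Lemma form_poly_rV d (p : {poly K}) : (size p <= d.+1)%N -> binary_form A B d p = form_lin d (poly_rV p).
Proof. by move=> sz; rewrite form_linE poly_rV_K. Qed.

Lemma limg_form d : limg (form_lin d) = (W ^+ d)%VS.
Proof.
apply/eqP; rewrite eqEsubv; apply/andP; split.
  apply/subvP => _ /memv_imgP[v _ ->]; rewrite form_linE.
  apply: memv_suml => k _; apply: memvZ.
  have kd : (k <= d)%N by rewrite -ltnS.
  rewrite -[X in (W ^+ X)%VS](subnKC kd) expvD; apply: memv_mul.
    by rewrite memvE -expv_line; apply: expvS; rewrite -memvE memv_span ?inE ?eqxx.
  by rewrite memvE -expv_line; apply: expvS; rewrite -memvE memv_span ?inE ?eqxx ?orbT.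
elim: d => [|d IH].
  rewrite expv0; apply/subvP => _ /vlineP[k ->]; apply: memvZ.
  apply/memv_imgP; exists (poly_rV 1); rewrite ?memvf // form_linE.
  rewrite poly_rV_K ?size_poly1 // /binary_form big_ord_recl big_ord0 addr0 /= coef1.
  by rewrite scale1r mulr1.
rewrite expvSl; apply/prodvP => u w; rewrite {1}/W span_cons span_seq1.
case/memv_addP => _ /vlineP[a ->] [_ /vlineP[b ->] ->].
case/(subvP IH)/memv_imgP => v _ ->.
have sz : (size (rVpoly v) <= d.+1)%N by apply: size_poly.
have szX : (size ('X * rVpoly v)%R <= d.+2)%N.
  by apply: leq_trans (size_polyMleq _ _) _; rewrite size_polyX.
rewrite mulrDl -!scalerAl form_linE -form_mulX -(form_succ AB sz).
rewrite !form_poly_rV //; last exact: leq_trans sz _.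
by apply: memvD; apply: memvZ; apply: memv_img; apply: memvf.
Qed.

Lemma form_mem d p : binary_form A B d p \in J d.
Proof.
rewrite max_ideal_pow_rec -limg_form; apply: (subvP (addvSl _ _)).
have -> : binary_form A B d p = form_lin d (\row_k p`_k).
  rewrite form_linE /binary_form; apply: eq_bigr => k _.
  by rewrite coef_rVpoly_ord mxE.
exact/memv_img/memvf.
Qed.

Lemma max_ideal_powP d x : x \in J d ->
  exists v, x - form_lin d v \in J d.+1.
Proof.
rewrite {1}max_ideal_pow_rec -limg_form => /memv_addP[_ /memv_imgP[v _ ->] [y hy ->]].
by exists v; rewrite addrC addKr.
Qed.

(** The degree d part of the ideal of relations of the associated graded
algebra. *)
Definition gr_rel d : {vspace 'rV[K]_d.+1} := (form_lin d @^-1: J d.+1)%VS.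

Lemma hilb_gr_rel d : (hilb A B d + \dim (gr_rel d) = d.+1)%N.
Proof.
rewrite /hilb -/(J d) -/(J d.+1).
have e1 := limg_ker_dim (form_lin d) fullv.
rewrite capfv (_ : \dim fullv = d.+1) in e1; last by rewrite dimvf dim_matrix mul1r.
have e2 := limg_ker_dim (form_lin d) (gr_rel d).
have e3 : (gr_rel d :&: lker (form_lin d) = lker (form_lin d))%VS.
  by apply/capv_idPr; rewrite -lpreim0 lpreimS ?sub0v.
have e4 : (form_lin d @: gr_rel d = J d.+1 :&: limg (form_lin d))%VS.
  by rewrite /gr_rel -lpreim_cap_limg lpreimK ?capvSr.
have e5 := dimv_sum_cap (limg (form_lin d)) (J d.+1).
rewrite {1}limg_form -max_ideal_pow_rec capvC -e4 in e5.
rewrite e3 in e2.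
have arith (a b c e f g : nat) : (a + b = d.+1 -> a + c = g -> e + c = b + f ->
  f <= e -> e - f + g = d.+1)%N by lia.
by apply: arith e1 e2 e5 _; apply/dimvS/max_ideal_pow_le.
Qed.

Lemma gr_relP d v : (v \in gr_rel d) = (binary_form A B d (rVpoly v) \in J d.+1).
Proof. by rewrite /gr_rel -memv_preim form_linE. Qed.

Lemma form_mem_gr d (p : {poly K}) : (size p <= d.+1)%N ->
  (poly_rV p \in gr_rel d) = (binary_form A B d p \in J d.+1).
Proof. by move=> sz; rewrite gr_relP poly_rV_K. Qed.

(** Both x V_d and y V_d lie in V_(d+1). If the dimension did not grow, they
would coincide, and then every element of V_d, as a polynomial, would be
divisible by every power of X. *)
Lemma gr_rel_grow d : (0 < \dim (gr_rel d))%N ->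
  (\dim (gr_rel d) < \dim (gr_rel d.+1))%N.
Proof.
move=> v0; pose U := gr_rel d.
pose sh : 'Hom('rV[K]_d.+1, 'rV[K]_d.+2) := linfun (poly_rV \o ('X \*o rVpoly)).
pose em : 'Hom('rV[K]_d.+1, 'rV[K]_d.+2) := linfun (poly_rV \o rVpoly).
have szr v : (size (rVpoly (v : 'rV[K]_d.+1)) <= d.+1)%N by apply: size_poly.
have szX v : (size ('X * rVpoly (v : 'rV[K]_d.+1))%R <= d.+2)%N.
  by apply: leq_trans (size_polyMleq _ _) _; rewrite size_polyX add2n /= ltnS.
have shE v : rVpoly (sh v) = 'X * rVpoly v by rewrite lfunE /= poly_rV_K.
have emE v : rVpoly (em v) = rVpoly v.
  by rewrite lfunE /= poly_rV_K //; apply: leq_trans (szr v) _.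
have sh_inj : lker sh == 0%VS.
  apply/lker0P => u v /(congr1 rVpoly); rewrite !shE => /(mulfI (negbT (polyX_eq0 _))).
  exact: (can_inj rVpolyK).
have em_inj : lker em == 0%VS.
  apply/lker0P => u v /(congr1 rVpoly); rewrite !emE; exact: (can_inj rVpolyK).
have d_sh : \dim (sh @: U) = \dim U by apply: limg_dim_eq; rewrite (eqP sh_inj) capv0.
have d_em : \dim (em @: U) = \dim U by apply: limg_dim_eq; rewrite (eqP em_inj) capv0.
have JG x y : x \in J 1 -> y \in J d.+1 -> x * y \in J d.+2.
  by move=> hx hy; have := max_ideal_pow_mul hx hy.
have inJ1 x : x \in W -> x \in J 1.
  by rewrite max_ideal_pow_rec expv1; apply: subvP; exact: addvSl.
have s_sh : (sh @: U <= gr_rel d.+1)%VS.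
  apply/subvP => _ /memv_imgP[u uU ->]; rewrite gr_relP shE form_mulX JG -?gr_relP //.
  by rewrite inJ1 // memv_span // inE eqxx.
have s_em : (em @: U <= gr_rel d.+1)%VS.
  apply/subvP => _ /memv_imgP[u uU ->]; rewrite gr_relP emE (form_succ AB) // JG -?gr_relP //.
  by rewrite inJ1 // memv_span // !inE eqxx orbT.
rewrite ltn_neqAle -{2}d_sh dimvS // andbT; apply/eqP => e.
have e1 : (sh @: U = gr_rel d.+1)%VS.
  by apply/eqP; rewrite eqEdim s_sh d_sh e leqnn.
have step u : u \in U -> exists2 u', u' \in U & rVpoly u = 'X * rVpoly u'.
  move=> uU; have := subvP s_em _ (memv_img em uU); rewrite -e1.
  by case/memv_imgP => u' hu' /(congr1 rVpoly); rewrite emE shE; exists u'.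
have all0 k u : u \in U -> (rVpoly u)`_k = 0.
  elim: k u => [|k IH] u /step[u' hu' ->]; first by rewrite coefXM.
  by rewrite coefXM /= IH.
move: v0; rewrite lt0n dimv_eq0 => /negP; apply; rewrite -subv0; apply/subvP => u /all0 hu.
by rewrite memv0 -[u]rVpolyK (_ : rVpoly u = 0) ?linear0 //; apply/polyP => k; rewrite hu coef0.
Qed.

End Filtration.

(** * The rank of the powers of a Lefschetz element *)

Section RankOfPencil.
Variables (K : fieldType) (n : nat) (A B : 'M[K]_n.+1).
Hypothesis AB : A * B = B * A.

Let G := gen_alg A B.
Let J d := max_ideal_pow A B d.
Let V d := gr_rel A B d.
Let h d := hilb A B d.

Lemma max_ideal_nilpotent : nilpotent_mx A -> nilpotent_mx B ->
  exists m, J m = 0%VS.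
Proof.
move=> [a A0] [b B0]; exists (a + b)%N.
rewrite /J max_ideal_powE // -limg_form //.
suff -> : limg (form_lin A B (a + b)) = 0%VS by rewrite prodv0.
apply/eqP; rewrite -subv0; apply/subvP => _ /memv_imgP[v _ ->].
rewrite form_linE memv0; apply/eqP; apply: big1 => k _.
have [ak|ka] := leqP a k.
  by rewrite -(subnKC ak) exprD A0 !mul0r scaler0.
have -> : (a + b - k = b + (a - k))%N by lia.
by rewrite exprD B0 mul0r mulr0 scaler0.
Qed.

Lemma sum_hilb d e : (d <= e)%N ->
  (\sum_(d <= k < e) h k + \dim (J e) = \dim (J d))%N.
Proof.
move=> /subnKC <-; elim: (e - d)%N => [|k IH].
  by rewrite addn0 big_geq.
rewrite addnS big_nat_recr ?leq_addr //= -addnA -[RHS]IH; congr addn.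
by rewrite /h /hilb subnK // dimvS // max_ideal_pow_le.
Qed.

Hypothesis nilA : nilpotent_mx A.
Hypothesis nilB : nilpotent_mx B.
Hypothesis dimG : \dim G = n.+1.

(** Nakayama's lemma, for a nilpotent ideal. *)
Lemma max_ideal_pow_stable d : J d.+1 = J d -> J d = 0%VS.
Proof.
move=> e; have [m Jm] := max_ideal_nilpotent nilA nilB.
have JS k : J k.+1 = (J k * <<[:: A; B]>>)%VS.
  by rewrite /J !(max_ideal_powE AB) expvSr prodvA.
have st k : J (d + k) = J d.
  by elim: k => [|k IH]; rewrite ?addn0 // addnS JS IH -JS e.
apply/eqP; rewrite -subv0 -Jm -(st m); apply: max_ideal_pow_le => //; exact: leq_addl.
Qed.

Lemma hilb_eq0 d : h d = 0%N -> J d = 0%VS.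
Proof.
move=> h0; apply: max_ideal_pow_stable; apply/eqP; rewrite eqEdim.
by rewrite max_ideal_pow_le //= -subn_eq0 -/(hilb A B d) -/(h d) h0.
Qed.

Lemma max_ideal_pow_socle : J (socle_degree A B).+1 = 0%VS.
Proof.
have Jn : J n.+1 = 0%VS.
  have [//|Jn] := eqVneq (J n.+1) 0%VS.
  have hp k : (k < n.+2)%N -> (0 < h k)%N.
    rewrite ltnS lt0n => kn; apply: contraNneq Jn => /hilb_eq0 Jk.
    by rewrite -subv0 -Jk; apply: max_ideal_pow_le.
  have := sum_hilb (leq0n n.+2); rewrite /J max_ideal_pow0 // -/G dimG => e.
  have : (\sum_(0 <= k < n.+2) 1 <= \sum_(0 <= k < n.+2) h k)%N.
    by rewrite !big_mkord; apply: leq_sum => k _; apply: hp.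
  rewrite sum_nat_const_nat subn0 muln1 leqNgt ltnS => /negP[].
  exact: leq_trans (leq_addr _ _) (eq_leq e).
have [jn|//] := eqVneq (socle_degree A B) n; first by rewrite jn.
have jn1 : (socle_degree A B <= n)%N by apply/bigmax_leqP => k _; rewrite -ltnS.
move=> ne; apply: hilb_eq0; apply/eqP; rewrite -/(h _).
have lt : ((socle_degree A B).+1 < n.+1)%N by rewrite ltnS ltn_neqAle ne.
apply: contraT => hne; have := @leq_bigmax_cond _ (fun i : 'I_n.+1 => hilb A B i != 0%N) (@nat_of_ord _) (Ordinal lt) hne.
by rewrite -/(socle_degree A B) ltnn.
Qed.

Lemma hilb_socle d : (socle_degree A B < d)%N -> h d = 0%N.
Proof.
move=> ld; have : J d = 0%VS.
  by apply/eqP; rewrite -subv0 -max_ideal_pow_socle max_ideal_pow_le.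
by rewrite /h /hilb -/(J d) => ->; rewrite dimv0.
Qed.

Let v d : nat := \dim (V d).

Lemma gr_rel_grows d e : (d <= e)%N -> (0 < v d)%N -> (v d + (e - d) <= v e)%N.
Proof.
move=> /subnKC <- v0; rewrite addKn; elim: (e - d)%N => [|k IH]; first by rewrite !addn0.
rewrite !addnS; apply: leq_ltn_trans (IH) _; apply: gr_rel_grow => //.
by apply: leq_trans v0 _; apply: leq_trans IH; apply: leq_addr.
Qed.

Lemma hilb_v d : (h d + v d = d.+1)%N.
Proof. exact: hilb_gr_rel. Qed.

(** In each degree the multiples of the i-th power of the linear form
x - mu y are in general position with respect to the relations. *)
Definition lefschetz (mu : K) : Prop :=
  forall d i, (d <= socle_degree A B)%N ->
   ((v d <= i)%N -> forall u, u \in V d -> ('X - mu%:P) ^+ i %| rVpoly u -> u = 0)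
   /\ ((i <= v d)%N -> forall w, exists2 u, u \in V d & ('X - mu%:P) ^+ i %| rVpoly (w - u)).

Lemma generically_lefschetz :
  char_zero_or_gt K (socle_degree A B) -> generically lefschetz.
Proof.
move=> hK; set j := socle_degree A B in hK *.
have hKd d : (d <= j)%N -> char_zero_or_gt K d.+1.-1.
  move=> dj; case: hK => [?|[p cp jp]]; first by left.
  by right; exists p => //; apply: leq_ltn_trans jp.
have g1 d : d \in iota 0 j.+1 -> generically (fun mu =>
     forall u, u \in V d -> ('X - mu%:P) ^+ v d %| rVpoly u -> u = 0).
  rewrite mem_iota ltnS => /hKd hd; exact: generic_nonosculating.
have g2 d : d \in iota 0 j.+1 -> generically (fun mu =>
   forall i, i \in iota 0 (v d).+1 ->
     forall w, exists2 u, u \in V d & ('X - mu%:P) ^+ i %| rVpoly (w - u)).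
  rewrite mem_iota ltnS => /hKd hd; apply: generically_all => i.
  rewrite mem_iota ltnS; exact: generic_osculating_complement.
have := generically_and (generically_all g1) (generically_all g2).
apply: generically_imp => mu [h1 h2] d i dj.
have dI : d \in iota 0 j.+1 by rewrite mem_iota.
split=> [le u uV dv|le w]; last by apply: h2; rewrite ?mem_iota.
by apply: (h1 d) => //; apply: dvdp_trans dv; apply: dvdp_exp2l.
Qed.

Section Rank.
Variables (mu : K) (i D : nat).
Hypothesis lef : lefschetz mu.
Hypothesis iD : (i <= D)%N.
Hypothesis below : forall d, (i <= d < D)%N -> (v d < i)%N.
Hypothesis above : forall d, (D <= d)%N -> (i <= v d)%N.
Let l := A - mu *: B.

Lemma pencil_max_ideal : l \in J 1.
Proof.
rewrite /J (max_ideal_pow_rec AB) expv1; apply: (subvP (addvSl _ _)).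
by apply: memvB; rewrite ?memvZ // memv_span // !inE eqxx ?orbT.
Qed.

Lemma pencilX_max_ideal k : l ^+ k \in J k.
Proof.
elim: k => [|k IH]; last by rewrite exprS; apply: (max_ideal_pow_mul AB (d := 1)); rewrite ?pencil_max_ideal.
rewrite /J max_ideal_pow0 // (subvP (sub1_agenv _)) // memv_line //.
Qed.

(** In the degrees d >= D the relations and the multiples of l^i together span
all forms, so each power of the ideal from the D-th on is reached modulo the
next one. *)
Lemma pencil_pow_onto : (J D <= amull (l ^+ i) @: J (D - i))%VS.
Proof.
have [m Jm] := max_ideal_nilpotent nilA nilB.
have st k : (J D <= amull (l ^+ i) @: J (D - i) + J (D + k))%VS.
  elim: k => [|k IH]; first by rewrite addn0 addvSr.
  apply: subv_trans IH _; rewrite subv_add addvSl /=; apply/subvP => x.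
  set d := (D + k)%N => hx; have [w hw] := max_ideal_powP AB hx.
  rewrite addnS -/d.
  have [u uV dv] : exists2 u, u \in V d & ('X - mu%:P) ^+ i %| rVpoly (w - u).
    have [dj|jd] := leqP d (socle_degree A B).
      by apply: (proj2 (lef i dj)); apply: above; exact: leq_addr.
    (* beyond the socle degree w itself is a relation *)
    exists w; last by rewrite subrr linear0 dvdp0.
    rewrite /V gr_relP; have -> : max_ideal_pow A B d.+1 = J d.
      have J0 e : (socle_degree A B < e)%N -> J e = 0%VS.
        by move=> le; apply/eqP; rewrite -subv0 -max_ideal_pow_socle max_ideal_pow_le.
      by rewrite (J0 d) // -/(J d.+1) J0 // ltnW.
    exact: form_mem.
  have /dvdpP[q eq_q] := dv.
  have sq : (size q <= (d - i).+1)%N.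
    have := size_poly d.+1 (fun k => if insub k is Some j then (w - u) 0 j else 0).
    rewrite -/(rVpoly (w - u)) eq_q.
    have [->|q0] := eqVneq q 0; first by rewrite size_poly0.
    rewrite size_Mmonic ?monic_exp ?monicXsubC // size_exp_XsubC addnS /= => sz.
    by rewrite -subSn ?leq_subRL 1?addnC //; rewrite /d; lia.
  have -> : x = amull (l ^+ i) (binary_form A B (d - i) q) + (form_lin A B d u + (x - form_lin A B d w)).
    rewrite lfunE /= -/l -(form_pencil AB mu i sq) subnK; last by rewrite /d; lia.
    rewrite mulrC -eq_q -form_linE linearB /=.
    by rewrite addrA subrK addrC subrK.
  apply: memv_add; last by rewrite memvD // form_linE -gr_relP.
  apply: memv_img; apply: (subvP (max_ideal_pow_le AB _)) (form_mem AB _ _).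
  by rewrite /d; lia.
have := st m; rewrite (_ : J (D + m) = 0%VS) ?addv0 //.
by apply/eqP; rewrite -subv0 -Jm max_ideal_pow_le // leq_addl.
Qed.

(** In the degrees d < D no nonzero multiple of l^i is a relation, so the
order of x grows by exactly i when x is multiplied by l^i. *)
Lemma pencil_pow_filtration x : x \in G -> l ^+ i * x \in J D -> x \in J (D - i).
Proof.
move=> xG lx; suff H e : (e <= D - i)%N -> x \in J e by apply: H.
elim: e => [|e IH] le; first by rewrite /J max_ideal_pow0.
have [w hw] := max_ideal_powP AB (IH (ltnW le)).
suff w0 : w = 0 by move: hw; rewrite w0 linear0 subr0.
set d := (e + i)%N; have dD : (d < D)%N by rewrite /d; lia.
have sz : (size (('X - mu%:P) ^+ i * rVpoly w)%R <= d.+1)%N.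
  apply: leq_trans (size_polyMleq _ _) _; rewrite size_exp_XsubC addSn /= /d addnC -addSn leq_add2r.
  exact: size_poly.
have dj : (d <= socle_degree A B)%N.
  rewrite leqNgt; apply/negP => /hilb_socle; have := hilb_v d; have := @below d; rewrite /d; lia.
have inV : poly_rV (('X - mu%:P) ^+ i * rVpoly w) \in V d.
  rewrite /V form_mem_gr // form_pencil //; last exact: size_poly.
  have -> : (A - mu *: B) ^+ i * binary_form A B e (rVpoly w)
     = l ^+ i * x - l ^+ i * (x - form_lin A B e w).
    by rewrite form_linE mulrBr subKr.
  apply: memvB; first exact: (subvP (max_ideal_pow_le AB dD)).
  have := max_ideal_pow_mul AB (pencilX_max_ideal i) hw.
  by rewrite addnS addnC.
have := proj1 (lef i dj) _ _ inV; rewrite poly_rV_K // => /(_ _ (dvdp_mulr _ (dvdpp _))).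
have vi : (v d <= i)%N by apply: ltnW; apply: below; rewrite dD andbT leq_addl.
move=> /(_ vi) /(congr1 rVpoly); rewrite poly_rV_K // linear0 => /eqP.
rewrite mulf_eq0 expf_eq0 polyXsubC_eq0 andbF /= => /eqP w0.
by rewrite -[w]rVpolyK w0 linear0.
Qed.

Lemma pencil_pow_rank :
  (\dim (amull (l ^+ i) @: G) + \sum_(D - i <= k < D) h k = n.+1)%N.
Proof.
have e1 := limg_ker_dim (amull (l ^+ i)) G.
have e2 := limg_ker_dim (amull (l ^+ i)) (J (D - i)).
have e3 : (amull (l ^+ i) @: J (D - i) = J D)%VS.
  apply/eqP; rewrite eqEsubv pencil_pow_onto andbT; apply/subvP => _ /memv_imgP[x hx ->].
  rewrite lfunE /=; have := max_ideal_pow_mul AB (pencilX_max_ideal i) hx.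
  by rewrite subnKC.
have e4 : (J (D - i) :&: lker (amull (l ^+ i)%R) = G :&: lker (amull (l ^+ i)%R))%VS.
  apply/eqP; rewrite eqEsubv capvS ?max_ideal_pow_sub //=.
  apply/subvP => x /memv_capP[xG xk]; rewrite memv_cap xk andbT.
  apply: pencil_pow_filtration => //; move: xk; rewrite memv_ker lfunE /= => /eqP->.
  exact: mem0v.
have e5 := sum_hilb (leq_subr i D).
move: e1 e2 e5; rewrite e3 e4 dimG; clear.
move: (\dim _) (\dim _) (\dim _) (\dim _) (\sum_(_ <= _ < _) _)%N => /= a b c d e.
by lia.
Qed.

End Rank.

Let j := socle_degree A B.

Lemma sum_hilbert : (\sum_(0 <= k < j.+1) h k = n.+1)%N.
Proof.
have := sum_hilb (leq0n j.+1).
by rewrite max_ideal_pow_socle dimv0 addn0 /J max_ideal_pow0 // -/G dimG.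
Qed.

Lemma hilbert_partition_is_partition : is_partition n.+1 (hilbert_partition A B).
Proof. by rewrite -sum_hilbert; apply: is_partition_dual; exact: hilb_socle. Qed.

Lemma hilbert_partition_strict : strictly_decreasing (hilbert_partition A B).
Proof.
apply: (@strictly_decreasing_dual h j.+1) => u /andP[u0 um].
have [d ud] : exists d, (u <= h d)%N.
  move: um; rewrite -/(hilbert_seq A B).
  case E : (sort geq _) => [|x s] /=; first by lia.
  have : x \in sort geq (hilbert_seq A B) by rewrite E mem_head.
  by rewrite mem_sort => /mapP[d _ ->] ?; exists d.
have hu : h u.-1 = u.
  have hvu := hilb_v u.-1; have hvd := hilb_v d.
  have [v0|v0] := posnP (v u.-1); first by lia.
  have := @gr_rel_grows u.-1 d _ v0; lia.
apply/mapP; exists u.-1; rewrite ?hu // mem_iota /= ltnS leqNgt.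
by apply/negP => /hilb_socle; rewrite hu; lia.
Qed.

(** The window of degrees from D - i to D - 1 carries i largest values of the
Hilbert function: to its left the values are at most D - i, from D on they are
at most D + 1 - i, and inside the window they are at least this. The only exception is
D = i with a Hilbert function that already vanishes in degree D - 1; then it
vanishes from D on as well and the threshold is 0. *)
Lemma lefschetz_jordan_rank mu i : lefschetz mu ->
  \dim (amull ((A - mu *: B) ^+ i) @: G) = jordan_rank (hilbert_partition A B) i.
Proof.
move=> lef; have [->|i0] := posnP i.
  rewrite jordan_rank0; case/and3P: hilbert_partition_is_partition => _ _ /eqP->.
  by rewrite expr0 amull1 lim1g dimG.
(* beyond the socle degree every form is a relation *)
have exD : exists D, (i <= D)%N && (i <= v D)%N.
  exists (maxn i j.+1); rewrite leq_maxl /=; have := hilb_v (maxn i j.+1).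
  by rewrite hilb_socle ?leq_maxr // add0n => ->; rewrite leqW ?leq_maxl.
case: (ex_minnP exD) => D /andP[iD vD] minD.
have above d : (D <= d)%N -> (i <= v d)%N.
  by move=> Dd; have := gr_rel_grows Dd; lia.
have below d : (i <= d < D)%N -> (v d < i)%N.
  by case/andP=> id dD; rewrite ltnNge; apply/negP => iv; have := minD d; rewrite id iv; lia.
have := pencil_pow_rank lef iD below above.
pose c := minn (h D.-1) (D - i).+1.
have hD1 := hilb_v D.-1; have hD := hilb_v D.
have hin d : (D - i <= d < D)%N -> (c <= h d)%N.
  move=> /andP[d1 d2]; have hd := hilb_v d; rewrite /c.
  have [v0|v0] := posnP (v d); first by lia.
  have := @gr_rel_grows d D.-1 _ v0; lia.
have hout d : ~~ (D - i <= d < D)%N -> (h d <= c)%N.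
  rewrite negb_and -ltnNge -leqNgt /c; have hd := hilb_v d.
  case/orP => [d1|d1].
    have := below D.-1; lia.
  have := gr_rel_grows d1; have := @gr_rel_grows D.-1 D; have [v0|v0] := posnP (v D.-1); lia.
have := jordan_rank_dual hilb_socle (leq_subr i D) hin hout.
rewrite subKn // -/j sum_hilbert -/(hilbert_seq A B) -/(hilbert_partition A B) => e1 e2.
by apply: (@addIn (\sum_(D - i <= k < D) h k)%N); rewrite e1 e2.
Qed.

End RankOfPencil.

(** * Jordan types and ranks *)

Section Offsets.
Local Open Scope nat_scope.
Variable P : seq nat.

Lemma reshape_offset_pred j : j < sumn P -> reshape_offset P j != 0 ->
  reshape_index P j.-1 = reshape_index P j
  /\ reshape_offset P j.-1 = (reshape_offset P j).-1.
Proof.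
move=> lj oj; have lo := reshape_offsetP lj; have ej := reshape_indexK P j.
set r := reshape_index P j in lo ej *; set o := reshape_offset P j in oj lo ej *.
have e : j.-1 = flatten_index P r o.-1 by rewrite -ej /flatten_index; lia.
rewrite e flatten_indexKl ?flatten_indexKr //; lia.
Qed.

Lemma reshape_index_succ i : i.+1 < sumn P ->
  (reshape_index P i == reshape_index P i.+1) = (reshape_offset P i.+1 != 0).
Proof.
move=> li; apply/eqP/idP => [e|o0]; last first.
  by case: (reshape_offset_pred li o0).
have := reshape_indexK P i.+1; have := reshape_indexK P i.
rewrite /flatten_index e; lia.
Qed.

Lemma map_reshape_offset :
  map (reshape_offset P) (iota 0 (sumn P)) = flatten (map (iota 0) P).
Proof.
have sh : shape (map (iota 0) P) = P.
  by rewrite /shape -map_comp -[RHS]map_id; apply: eq_map => p /=; rewrite size_iota.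
apply: (@eq_from_nth _ 0); first by rewrite size_flatten sh size_map size_iota.
move=> j; rewrite size_map size_iota => lj.
rewrite (nth_map 0) ?size_iota // nth_iota // add0n nth_flatten sh.
rewrite (nth_map 0) ?reshape_indexP // nth_iota //; exact: reshape_offsetP.
Qed.

(** The i-th power of the Jordan matrix keeps the basis vectors whose
position in their block is at least i. *)
Lemma count_reshape_offset i :
  count (fun j => i <= reshape_offset P j) (iota 0 (sumn P)) = jordan_rank P i.
Proof.
have -> : count (fun j => i <= reshape_offset P j) (iota 0 (sumn P))
        = count (leq i) (map (reshape_offset P) (iota 0 (sumn P))).
  by rewrite count_map.
rewrite map_reshape_offset count_flatten /jordan_rank sumnE !big_map.
apply: eq_bigr => p _; elim: p => [|p IH] //.
by rewrite -addn1 iotaD count_cat /= IH; lia.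
Qed.

End Offsets.

Lemma free_subset (K : fieldType) (V : vectType K) (X Y : seq V) :
  free Y -> uniq X -> {subset X <= Y} -> free X.
Proof.
move=> fY uX sXY; have := filter_free (mem X) fY; congr (_ = _); apply: perm_free.
apply: uniq_perm => [|//|x]; [by rewrite filter_uniq ?free_uniq | rewrite mem_filter].
by change (mem X x) with (x \in X); apply: andb_idr; apply: sXY.
Qed.

Section JordanType.
Variables (K : fieldType) (V : vectType K).
Implicit Types (E : {vspace V}) (f g : 'End(V)).

Lemma sum_jordan_nilp (P : seq nat) (F : nat -> V) (j : 'I_(sumn P)) :
  \sum_i jordan_nilp K (sumn P) P i j *: F i
    = if reshape_offset P j == 0%N then 0 else F j.-1.
Proof.
have [j0|j0] := posnP j.
  have -> : reshape_offset P j = 0%N by have := reshape_indexK P j; rewrite /flatten_index; lia.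
  by rewrite eqxx big1 // => i _; rewrite mxE j0 scale0r.
have lj : (j.-1 < sumn P)%N by have := ltn_ord j; lia.
have eqj : nat_of_ord j = j.-1.+1 by lia.
rewrite (bigD1 (Ordinal lj)) //= mxE /= -eqj eqxx /= big1 ?addr0; last first.
  move=> i ne; rewrite mxE; case: eqP => [e|_]; last by rewrite scale0r.
  by case/eqP: ne; apply/val_inj; rewrite /= e.
have := @reshape_index_succ P j.-1; rewrite -eqj => ->; last exact: ltn_ord.
by case: eqP => _; rewrite ?scale0r ?scale1r.
Qed.

(** A Jordan operator shifts the basis by one place inside each block. *)
Lemma iter_jordan_basis (P : seq nat) (e : seq V) (f : V -> V) (i j : nat) :
  (f 0 = 0) ->
  (forall j, (j < sumn P)%N ->
     f e`_j = if reshape_offset P j == 0%N then 0 else e`_j.-1) ->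
  (j < sumn P)%N ->
  iter i f e`_j = if (i <= reshape_offset P j)%N then e`_(j - i) else 0.
Proof.
move=> f0 fe; elim: i j => [|i IH] j lj; first by rewrite subn0.
rewrite iterSr fe //; case: eqP => [->|/eqP o0].
  by elim: i {IH} => //= i ->.
have [_ eo] := reshape_offset_pred lj o0.
rewrite IH ?eo; last by lia.
have -> : (j.-1 - i = j - i.+1)%N by lia.
by congr (if _ then _ else _); lia.

Qed.

Lemma has_jordan_typeP E (f : V -> V) P :
  has_jordan_type E f P <-> is_partition (\dim E) P /\
   exists2 e : seq V, basis_of E e & forall j, (j < sumn P)%N ->
     f e`_j = if reshape_offset P j == 0%N then 0 else e`_j.-1.
Proof.
split=> [[hP [e eE fe]]|[hP [e eE fe]]]; split=> //.
  exists e => // j lj; have := fe (Ordinal lj).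
  rewrite (eq_bigr (fun i => jordan_nilp K (sumn P) P i (Ordinal lj) *: e`_i)).
    by rewrite sum_jordan_nilp (tnth_nth 0).
  by move=> i _; rewrite (tnth_nth 0).
have sz : size e == sumn P.
  case/and3P: hP => _ _ /eqP->; apply/eqP.
  exact: (esym (size_basis (X := in_tuple e) eE)).
exists (Tuple sz) => // j; rewrite (tnth_nth 0) /= fe //.
rewrite (eq_bigr (fun i : 'I__ => jordan_nilp K (sumn P) P i j *: e`_i)).
  by rewrite sum_jordan_nilp.
by move=> i _; rewrite (tnth_nth 0).
Qed.

Lemma jordan_type_rank E (f : V -> V) P i (h : 'End(V)) :
  f 0 = 0 -> (forall x, h x = iter i f x) -> has_jordan_type E f P ->
  \dim (h @: E) = jordan_rank P i.
Proof.
move=> f0 hf /has_jordan_typeP[hP [e eE fe]].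
have sz : size e = sumn P.
  by case/and3P: hP => _ _ /eqP->; exact: (esym (size_basis (X := in_tuple e) eE)).
pose s := [seq j <- iota 0 (sumn P) | (i <= reshape_offset P j)%N].
have -> : (h @: E = <<[seq e`_(j - i) | j <- s]>>)%VS.
  rewrite -(span_basis eE) limg_span; apply/eqP; rewrite eqEsubv.
  apply/andP; split; apply/span_subvP => x.
    move=> /mapP[y /(nthP 0)[j lj <-] ->]; rewrite sz in lj.
    rewrite hf (iter_jordan_basis i f0 fe lj); case: ifP => io; last exact: mem0v.
    by apply: memv_span; apply: map_f; rewrite mem_filter io mem_iota.
  case/mapP => j; rewrite mem_filter mem_iota /= => /andP[io lj] ->.
  apply: memv_span; apply/mapP; exists e`_j; first by rewrite mem_nth ?sz.
  by rewrite hf (iter_jordan_basis i f0 fe lj) io.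
have fr : free [seq e`_(j - i) | j <- s].
  have le : {in s, forall j, (i <= j < sumn P)%N}.
    move=> j; rewrite mem_filter mem_iota /= => /andP[io lj]; rewrite lj andbT.
    have := reshape_indexK P j; rewrite /flatten_index; lia.
  apply: free_subset (basis_free eE) _ _; last first.
    by move=> x /mapP[j /le lj ->]; rewrite mem_nth ?sz //; lia.
  rewrite map_inj_in_uniq ?filter_uniq ?iota_uniq // => a b /le la /le lb /eqP.
  by rewrite nth_uniq ?sz ?(free_uniq (basis_free eE)) //; lia.
rewrite (eqP fr) size_map size_filter; exact: count_reshape_offset.
Qed.
End JordanType.

(** * Jordan bases adapted to a commuting operator *)

Section TriangularJordanBasis.
Variables (K : fieldType) (V : vectType K).
Implicit Types (E Z : {vspace V}) (f g : 'End(V)).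

Definition nilpotent_on E f := exists k, forall x, x \in E -> iter k f x = 0.

Lemma nilpotent_onS E E' f : (E' <= E)%VS -> nilpotent_on E f -> nilpotent_on E' f.
Proof. by move=> /subvP sub [k fk]; exists k => x /sub/fk. Qed.

Lemma iter_stable E f k x : (f @: E <= E)%VS -> x \in E -> iter k f x \in E.
Proof. by move=> fE xE; elim: k => //= k /(memv_img f)/(subvP fE). Qed.

(** A nilpotent operator of Z/Z' has a basis in which it is strictly
triangular; the basis is built from its end, by vectors that are mapped into the
space obtained so far. *)
Lemma triangular_complement g Z' Z : (Z' <= Z)%VS -> (g @: Z' <= Z')%VS ->
  (g @: Z <= Z)%VS -> nilpotent_on Z g ->
  exists z : seq V, [/\ (size z + \dim Z' = \dim Z)%N, Z = (Z' + <<z>>)%VS &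
    forall i, (i < size z)%N -> g z`_i \in (Z' + <<drop i.+1 z>>)%VS].
Proof.
move=> sZ gZ' gZ [k gk].
have [m em] : exists m, (m + \dim Z' = \dim Z)%N.
  by exists (\dim Z - \dim Z')%N; rewrite subnK // dimvS.
elim: m Z' sZ gZ' em => [|m IH] Z' sZ gZ' em.
  have eZ : Z' = Z by apply/eqP; rewrite eqEdim sZ -em leqnn.
  by exists [::]; rewrite span_nil addv0 add0n eZ.
have /subvPn[x xZ xZ'] : ~~ (Z <= Z')%VS.
  by apply/negP => /dimvS; rewrite -em; lia.
have ex : exists k, iter k g x \in Z' by exists k; rewrite gk ?mem0v.
case: (ex_minnP ex) => -[|r] hr minr; first by rewrite hr in xZ'.
set z0 := iter r g x.
have z0Z : z0 \in Z by apply: iter_stable.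
have z0Z' : z0 \notin Z' by apply/negP => /minr; rewrite ltnn.
pose Z'' := (Z' + <[z0]>)%VS.
have z0n : z0 != 0 by apply: contraNneq z0Z' => ->; exact: mem0v.
have dZ'' : \dim Z'' = (\dim Z').+1.
  rewrite /Z'' dimv_disjoint_sum ?dim_vline ?z0n ?addn1 //.
  apply/eqP; rewrite -subv0; apply/subvP => y /memv_capP[yZ /vlineP[c ec]].
  rewrite ec memv0 in yZ *; have [->|c0] := eqVneq c 0; first by rewrite scale0r.
  by case/negP: z0Z'; rewrite -[z0](scalerK c0) memvZ.
have [|||z [sz eZ hz]] := IH Z''.
- by rewrite subv_add sZ -memvE.
- rewrite limgD limg_line subv_add (subv_trans gZ' (addvSl _ _)) -memvE.
  exact: (subvP (addvSl _ _)).
- by rewrite dZ'' addnS -addSn.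
exists (rcons z z0); split.
- by rewrite size_rcons -sz dZ'' addnS addSn.
- by rewrite eZ /Z'' -cats1 span_cat span_seq1 -!addvA [(_ + <<z>>)%VS]addvC.
- move=> i; rewrite size_rcons ltnS leq_eqVlt => /orP[/eqP->|li].
    by rewrite nth_rcons ltnn eqxx (subvP (addvSl _ _)).
  rewrite nth_rcons li drop_rcons // -cats1 span_cat span_seq1 addvA.
  by rewrite -addvA [(<<_>> + _)%VS]addvC addvA; apply: hz.
Qed.

Definition chain_basis f (L : seq (V * nat)) : seq V :=
  flatten [seq [seq iter k f c.1 | k <- rev (iota 0 c.2)] | c <- L].

(** L lists the generators of the Jordan blocks of f with the lengths of the
blocks. The operator g moves each generator to later generators, modulo the
image of f. *)
Definition triangular_chains f g E (L : seq (V * nat)) : Prop :=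
  [/\ basis_of E (chain_basis f L),
      forall c, c \in L -> iter c.2 f c.1 = 0,
      sorted geq (map snd L),
      all (leq 1) (map snd L) &
      forall i, (i < size L)%N ->
        g (nth (0, 0%N) L i).1 \in (f @: E + <<map fst (drop i.+1 L)>>)%VS].

Lemma mem_chain_basis f L c k : c \in L -> (k < c.2)%N ->
  iter k f c.1 \in chain_basis f L.
Proof.
move=> cL kc; apply/flattenP; exists [seq iter k f c.1 | k <- rev (iota 0 c.2)].
  by apply: map_f.
by apply: map_f; rewrite mem_rev mem_iota.
Qed.

Lemma chain_basisP f L x : x \in chain_basis f L ->
  exists2 c, c \in L & exists2 k, (k < c.2)%N & x = iter k f c.1.
Proof.
case/flattenP => _ /mapP[c cL ->] /mapP[k]; rewrite mem_rev mem_iota => kc ->.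
by exists c => //; exists k.
Qed.

Lemma shape_chain f L :
  shape [seq [seq iter k f c.1 | k <- rev (iota 0 c.2)] | c <- L] = map snd L.
Proof. by rewrite /shape -map_comp; apply: eq_map => c /=; rewrite size_map size_rev size_iota. Qed.

Lemma size_chain_basis f L : size (chain_basis f L) = sumn (map snd L).
Proof. by rewrite size_flatten shape_chain. Qed.

(** Induction from f(E) to E: lift the generators of f(E) along f, and add
a complement, triangular for g, of the kernel of f on f(E) in the kernel of f on
E. Lifting keeps the triangular shape modulo the kernel of f on E, which lies in the
span of f(E) and the added vectors. The induction also records that the number of blocks is
the dimension of the kernel, as this makes the dimensions add up. *)
Lemma triangular_chains_exist f g E : (forall x, f (g x) = g (f x)) ->
  (f @: E <= E)%VS -> (g @: E <= E)%VS -> nilpotent_on E f -> nilpotent_on E g ->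
  exists L, triangular_chains f g E L.
Proof.
move=> fg fE gE [k]; move: fE gE.
suff H : (f @: E <= E)%VS -> (g @: E <= E)%VS ->
    (forall x, x \in E -> iter k f x = 0) -> nilpotent_on E g ->
    exists2 L, triangular_chains f g E L & size L = \dim (E :&: lker f).
  by move=> h1 h2 h3 h4; have [L] := H h1 h2 h3 h4; exists L.
elim: k E => [|k IH] E fE gE fk gn.
  have -> : E = 0%VS by apply/eqP; rewrite -subv0; apply/subvP => x /fk /= ->; exact: mem0v.
  by exists [::]; rewrite ?cap0v ?dimv0 //; split=> //; exact: nil_basis.
set E' := (f @: E)%VS.
have gE' : (g @: E' <= E')%VS.
  apply/subvP => _ /memv_imgP[_ /memv_imgP[x xE ->] ->]; rewrite -fg memv_img //.
  by apply: (subvP gE); apply: memv_img.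
have [||||L' [hb h0 hs hp hg] hsz] := IH E'.
- exact: limgS.
- exact: gE'.
- by move=> _ /memv_imgP[x xE ->]; rewrite -iterSr fk.
- exact: nilpotent_onS gn.
(* a preimage under f that lies in E *)
pose pre w := projv E ((f \o projv E)^-1%VF w).
have preE w : pre w \in E by exact: memv_proj.
have fpre w : w \in E' -> f (pre w) = w.
  move=> hw; rewrite /pre -[f _]comp_lfunE; apply: limg_lfunVK.
  by rewrite limg_comp limg_proj.
pose Z := (E :&: lker f)%VS; pose Z' := (E' :&: lker f)%VS.
have gker : (g @: lker f <= lker f)%VS.
  by apply/subvP => _ /memv_imgP[x hx ->]; move: hx; rewrite !memv_ker fg => /eqP->; rewrite linear0.
have gcap U : (g @: U <= U)%VS -> (g @: (U :&: lker f) <= U :&: lker f)%VS.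
  by move=> gU; apply: subv_trans (limg_cap _ _ _) _; apply: capvS.
have [z [sz eZ hz]] := triangular_complement (capvS fE (subvv _)) (gcap _ gE') (gcap _ gE)
   (nilpotent_onS (capvSl _ _) gn).
rewrite -/Z -/Z' in sz eZ hz.
pose L1 := [seq (pre c.1, c.2.+1) | c <- L'].
pose L2 := [seq (x, 1%N) | x <- z].
have L'E' c : c \in L' -> c.1 \in E'.
  move=> cL; have c0 : (0 < c.2)%N by apply: (allP hp); apply: map_f.
  by have := basis_mem hb (mem_chain_basis f cL c0).
have zZ x : x \in z -> x \in Z.
  by move=> xz; rewrite eZ (subvP (addvSr _ _)) ?memv_span.
have iter_pre c j : c \in L' -> iter j.+1 f (pre c.1) = iter j f c.1.
  by move=> /L'E' hc; rewrite iterSr fpre.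
exists (L1 ++ L2); last first.
  by rewrite size_cat !size_map hsz addnC -/Z' sz.
set S := <<chain_basis f (L1 ++ L2)>>%VS.
have inL1 c : c \in L' -> (pre c.1, c.2.+1) \in L1 ++ L2.
  by move=> cL; rewrite mem_cat; apply/orP; left; apply/mapP; exists c.
have inS1 c j : c \in L' -> (j < c.2.+1)%N -> iter j f (pre c.1) \in S.
  by move=> /inL1 cL jc; apply/memv_span/(mem_chain_basis f cL).
have inS2 x : x \in z -> x \in S.
  move=> xz; apply/memv_span/(@mem_chain_basis f (L1 ++ L2) (x, 1%N) 0%N) => //.
  by rewrite mem_cat; apply/orP; right; apply: map_f.
have sE'S : (E' <= S)%VS.
  rewrite -(span_basis hb); apply/span_subvP => x /chain_basisP[c cL [j jc ->]].
  by rewrite -iter_pre //; apply: inS1.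
have sE'fS : (E' <= f @: S)%VS.
  rewrite -(span_basis hb); apply/span_subvP => x /chain_basisP[c cL [j jc ->]].
  by rewrite -iter_pre //= memv_img // inS1 // leqW.
have sSE : (S <= E)%VS.
  apply/span_subvP => x /chain_basisP[c]; rewrite mem_cat => /orP[] /mapP[y yL ->] [j _ ->].
    by apply: iter_stable => //; apply: preE.
  by apply: iter_stable => //; have /memv_capP[] := zZ _ yL.
split.
- rewrite basisEdim; apply/andP; split.
    apply/subvP => x xE; have /(subvP sE'fS)/memv_imgP[y yS fxy] := memv_img f xE.
    rewrite -[x](subrK y) memvD //; have : x - y \in Z.
      apply/memv_capP; split; last by rewrite memv_ker linearB /= fxy subrr.
      by apply: memvB => //; apply: (subvP sSE).
    rewrite eZ => /memv_addP[u /memv_capP[uE' _] [w wz ->]].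
    rewrite memvD ?(subvP sE'S u) //; apply: (subvP _ _ wz).
    by apply/span_subvP.
  rewrite size_chain_basis map_cat sumn_cat -!map_comp.
  have -> : sumn [seq (snd \o (fun x : V => (x, 1%N))) i | i <- z] = size z.
    by rewrite sumnE big_map /= sum1_size.
  have -> : sumn [seq (snd \o (fun c => (pre c.1, c.2.+1))) i | i <- L'] = (sumn (map snd L') + size L')%N.
    rewrite !sumnE !big_map /= -sum1_size -big_split /=.
    by apply: eq_bigr => c _; rewrite addn1.
  rewrite -(size_chain_basis f) hsz -/Z' -addnA [(\dim Z' + _)%N]addnC sz.
  have -> : size (chain_basis f L') = \dim E' by rewrite (size_basis (X := in_tuple _) hb).
  by rewrite addnC limg_ker_dim.
- move=> c; rewrite mem_cat => /orP[] /mapP[y yL ->].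
    by rewrite [LHS]iter_pre // h0.
  by apply/eqP; have /memv_capP[_] := zZ _ yL; rewrite memv_ker.
- rewrite map_cat -!map_comp.
  have geq_tr : transitive geq by move=> a b c /=; lia.
  rewrite sorted_pairwise // pairwise_cat; apply/and3P; split.
  + by apply/allrelP => _ _ /mapP[c cL ->] /mapP[x xz ->].
  + by move: hs; rewrite sorted_pairwise // !pairwise_map.
  + by rewrite pairwise_map; elim: (z) => //= x s ->; rewrite andbT; apply/allP.
- rewrite map_cat all_cat -!map_comp; by apply/andP; split; apply/allP => _ /mapP[c _ ->].
- have Z'E' : (Z' <= E')%VS by apply: capvSl.
  move=> i; rewrite size_cat nth_cat [size L1]size_map [size L2]size_map => li.
  have [il|il] := ltnP i (size L'); last first.
    rewrite drop_cat [size L1]size_map ltnNge (leq_trans il (leqnSn _)) /=.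
    have lz : (i - size L' < size z)%N by rewrite ltn_subLR.
    rewrite subSn // (nth_map 0) //=.
    rewrite -map_drop -map_comp map_id; apply: (subvP (addvS Z'E' (subvv _))).
    exact: hz.
  have -> : drop i.+1 (L1 ++ L2) = drop i.+1 L1 ++ L2.
    rewrite drop_cat; case: ltnP => // le1.
    have /eqP-> : (i.+1 - size L1 == 0)%N by rewrite subn_eq0 size_map.
    by rewrite drop0 drop_oversize.
  rewrite (nth_map (0, 0%N)) //=; set w := (nth (0, 0%N) L' i).1.
  have wE' : w \in E' by apply/L'E'/mem_nth.
  have eq1 : map fst (drop i.+1 L1) = map pre (map fst (drop i.+1 L')).
    by rewrite -map_drop -!map_comp.
  have eq2 : map fst L2 = z by rewrite -map_comp map_id.
  rewrite map_cat span_cat eq1 eq2; set T := <<map pre _>>%VS.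
  have fT : (f @: T = <<map fst (drop i.+1 L')>>)%VS.
    rewrite limg_span -map_comp; congr <<_>>%VS; rewrite -[RHS]map_id; apply/eq_in_map.
    by move=> u /mapP[c /mem_drop cL ->] /=; rewrite fpre // L'E'.
  have := hg i il; rewrite -/w -fT => /memv_addP[_ /memv_imgP[y yE' ->] [_ /memv_imgP[t tT ->] e]].
  have TE : (T <= E)%VS by apply/span_subvP => u /mapP[v _ ->].
  have : g (pre w) - (y + t) \in Z.
    apply/memv_capP; split.
      apply: memvB; first by apply: (subvP gE); apply: memv_img.
      by apply: memvD; [apply: (subvP fE) | apply: (subvP TE)].
    by rewrite memv_ker linearB linearD /= fg fpre // e subrr.
  rewrite eZ => /memv_addP[u uZ' [v vz eqv]].
  rewrite -[g _](subrK (y + t)) eqv addrACA memv_add ?memvD ?(subvP Z'E' u) //.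
  - exact: (subvP (addvSr _ _)).
  - exact: (subvP (addvSl _ _)).
Qed.

End TriangularJordanBasis.

Section Chains.
Variables (K : fieldType) (V : vectType K).
Implicit Types (E : {vspace V}) (f g : 'End(V)) (L : seq (V * nat)).

Lemma iter0 f k : iter k f 0 = 0.
Proof. by elim: k => //= k ->; rewrite linear0. Qed.

Lemma iter_comm f g k x : (forall x, f (g x) = g (f x)) ->
  iter k f (g x) = g (iter k f x).
Proof. by move=> fg; elim: k => //= k ->. Qed.

Section Nth.
Variables (f : 'End(V)) (L : seq (V * nat)).
Let P := map snd L.
Let c j := nth (0%R, 0%N) L (reshape_index P j).

Lemma nth_chain_basis j : (j < sumn P)%N ->
  (chain_basis f L)`_j = iter ((c j).2 - (reshape_offset P j).+1) f (c j).1.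
Proof.
move=> lj; rewrite nth_flatten shape_chain -/P.
have lr := reshape_indexP lj; have lo := reshape_offsetP lj.
rewrite size_map in lr; rewrite (nth_map (0%R, 0%N)) // in lo.
rewrite (nth_map (0%R, 0%N)) // -/(c j) in lo *.
rewrite (nth_map 0%N) ?size_rev ?size_iota // nth_rev ?size_iota // nth_iota //.
by rewrite ltn_subrL /=; exact: leq_ltn_trans lo.
Qed.

Lemma chain_basis_action j : (forall c, c \in L -> iter c.2 f c.1 = 0) ->
  (j < sumn P)%N -> f (chain_basis f L)`_j =
    if reshape_offset P j == 0%N then 0 else (chain_basis f L)`_j.-1.
Proof.
move=> h0 lj; rewrite nth_chain_basis //.
have lr := reshape_indexP lj; have lo := reshape_offsetP lj.
rewrite size_map in lr; rewrite (nth_map (0%R, 0%N)) // -/(c j) in lo.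
rewrite -iterS; case: eqP => [o0|/eqP o0].
  rewrite o0 subn1 prednK; last exact: leq_ltn_trans lo.
  by apply/h0/mem_nth.
have [e1 e2] := reshape_offset_pred lj o0.
rewrite nth_chain_basis ?e2; last exact: leq_ltn_trans (leq_pred _) lj.
by rewrite /c e1 -/(c j) prednK ?lt0n // subnSK.
Qed.

Lemma chain_basis_chain r k : (r < size L)%N -> (k < (nth (0%R, 0%N) L r).2)%N ->
  exists j, [/\ (j < sumn P)%N, reshape_index P j = r &
    reshape_offset P j = ((nth (0%R, 0%N) L r).2 - k.+1)%N].
Proof.
move=> lr lk; exists (flatten_index P r ((nth (0%R, 0%N) L r).2 - k.+1)).
have lo : ((nth (0%R, 0%N) L r).2 - k.+1 < nth 0 P r)%N.
  by rewrite (nth_map (0%R, 0%N)) // ltn_subrL /=; exact: leq_ltn_trans lk.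
by rewrite flatten_indexKl // flatten_indexKr // flatten_indexP.
Qed.

End Nth.

Lemma has_jordan_type_chains f g E L :
  triangular_chains f g E L -> has_jordan_type E f (map snd L).
Proof.
move=> [hb h0 hs hp _]; apply/has_jordan_typeP; split.
  rewrite /is_partition hs hp /= -(size_chain_basis f).
  by rewrite (size_basis (X := in_tuple _) hb).
by exists (chain_basis f L) => // j; apply: chain_basis_action.
Qed.

Lemma has_jordan_type_exists f E : (f @: E <= E)%VS -> nilpotent_on E f ->
  exists P, has_jordan_type E f P.
Proof.
move=> fE fn; have [| | | |L hL] := @triangular_chains_exist K V f 0 E _ fE.
- by move=> x; rewrite !zero_lfunE linear0.
- by rewrite lim0g sub0v.
- exact: fn.
- by exists 1%N => x _; rewrite /= zero_lfunE.
by exists (map snd L); apply: has_jordan_type_chains hL.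
Qed.

Definition triangular_along f E L g : Prop :=
  forall i, (i < size L)%N ->
    g (nth (0%R, 0%N) L i).1 \in (f @: E + <<map fst (drop i.+1 L)>>)%VS.

(** Only the triangular shape with respect to one fixed list of chains is used
here; it is a linear condition on g, so it cuts out a linear space of nilpotent
operators. *)
Lemma nilpotent_triangular f g g' E L : (forall x, f (g x) = g (f x)) ->
  (f @: E <= E)%VS -> (g @: E <= E)%VS -> nilpotent_on E f ->
  triangular_chains f g' E L -> triangular_along f E L g -> nilpotent_on E g.
Proof.
move=> fg fE gE [k fk] [hb _ _ hp _] hg.
(* a flag from E down to f(E) that g lowers by one step *)
pose F i := (f @: E + <<map fst (drop i L)>>)%VS.
have EF : (E <= F 0%N)%VS.
  rewrite /F drop0 -{1}(span_basis hb); apply/span_subvP => x /chain_basisP[c cL [[|j] jc ->]].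
    by apply/(subvP (addvSr _ _))/memv_span/map_f.
  rewrite (subvP (addvSl _ _)) //= memv_img //; apply: (iter_stable _ fE).
  by apply: (basis_mem hb (mem_chain_basis f cL (k := 0) _)); exact: leq_trans jc.
have gfE : (g @: (f @: E) <= f @: E)%VS.
  apply/subvP => _ /memv_imgP[_ /memv_imgP[x xE ->] ->]; rewrite -fg memv_img //.
  by apply: (subvP gE); apply: memv_img.
have Fle i j : (i <= j)%N -> (F j <= F i)%VS.
  move=> ij; apply: addvS; first exact: subvv.
  apply: sub_span => x /mapP[c cj ->]; apply: map_f.
  by rewrite -(subnK ij) -drop_drop in cj; apply: mem_drop cj.
have gF i : (g @: F i <= F i.+1)%VS.
  rewrite /F limgD subv_add (subv_trans gfE (addvSl _ _)) /= limg_span.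
  apply/span_subvP => _ /mapP[_ /mapP[c cL ->] ->].
  case/(nthP (0%R, 0%N)): cL => m; rewrite size_drop nth_drop => lm <-.
  apply: (subvP (Fle i.+1 (i + m).+1 _)); first by rewrite ltnS leq_addr.
  by apply: hg; rewrite -ltn_subRL.
have gEF s x : x \in E -> iter s g x \in F s.
  by elim: s => [|s IH] xE; [exact: (subvP EF) | apply/(subvP (gF s))/memv_img/IH].
have down x : x \in E -> exists2 y, y \in E & iter (size L) g x = f y.
  move=> /(gEF (size L)); rewrite /F drop_size span_nil addv0.
  by case/memv_imgP => y; exists y.
have down' m x : x \in E -> exists2 y, y \in E & iter (m * size L) g x = iter m f y.
  elim: m x => [|m IH] x xE; first by exists x.
  have [y yE e] := IH x xE; have [z zE e'] := down y yE.
  exists z => //; rewrite mulSn iterD e iterSr -e'.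
  by elim: (size L) => //= s ->; rewrite iter_comm.
exists (k * size L)%N => x /(down' k)[y yE ->]; exact: fk.
Qed.

(** Two Jordan bases of f with the same block sizes are exchanged by an
automorphism that commutes with f. *)
Lemma chains_conjugate f g g' L L' :
  triangular_chains f g fullv L -> triangular_chains f g' fullv L' ->
  map snd L = map snd L' ->
  exists G : 'End(V), [/\ lker G = 0%VS, forall x, f (G x) = G (f x) &
    forall i, G (nth (0%R, 0%N) L' i).1 = (nth (0%R, 0%N) L i).1].
Proof.
move=> [hb h0 _ hp _] [hb' h0' _ hp' _] eP.
set e := chain_basis f L in hb *; set e' := chain_basis f L' in hb' *.
have sze : size e = size e' by rewrite !size_chain_basis eP.
have [F hF] := linear_of_free e' e.
have Fe j : (j < sumn (map snd L))%N -> F e'`_j = e`_j.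
  move=> lj; rewrite -(nth_map 0 0) ?hF ?(basis_free hb') //.
  by rewrite -sze size_chain_basis.
exists (linfun F); split.
- have e1 : limg (linfun F) = fullv.
    rewrite -{1}(span_basis hb') limg_span (_ : map _ e' = e) ?(span_basis hb) //.
    by rewrite -[RHS]hF ?(basis_free hb') //; apply: eq_map => x; rewrite lfunE.
  have := limg_ker_dim (linfun F) fullv; rewrite e1 capfv => /eqP.
  by rewrite -[X in _ == X]add0n eqn_add2r dimv_eq0 => /eqP.
- suff : (f \o linfun F)%VF = (linfun F \o f)%VF.
    by move=> E x; move/lfunP: E => /(_ x); rewrite !comp_lfunE.
  apply/(fullv_lfunP _ _ (span_basis hb')) => x /(nthP 0)[j].
  rewrite -sze size_chain_basis => lj <-; rewrite !comp_lfunE !lfunE /= Fe //.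
  rewrite !chain_basis_action -?eP //; case: eqP => _; first by rewrite linear0.
  by rewrite Fe //; exact: leq_ltn_trans (leq_pred _) lj.
- move=> i; have [li|li] := ltnP i (size L); last first.
    have li' : (size L' <= i)%N by rewrite -(size_map snd) -eP size_map.
    by rewrite !nth_default //= linear0.
  have li' : (i < size L')%N by rewrite -(size_map snd) -eP size_map.
  have nthP2 : (nth (0%R, 0%N) L' i).2 = (nth (0%R, 0%N) L i).2.
    by rewrite -!(nth_map _ 0%N) // eP.
  have l0 : (0 < (nth (0%R, 0%N) L i).2)%N by apply/(allP hp)/map_f/mem_nth.
  have [j [lj rj oj]] := chain_basis_chain li l0.
  have := Fe j lj; rewrite !nth_chain_basis -?eP // rj oj nthP2.
  by rewrite subnSK // subn0 subnn lfunE.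
Qed.

(** The generator of each block goes to that of the next one. This is
compatible with f because the lengths of the blocks do not increase. *)
Lemma chain_shift f g L : triangular_chains f g fullv L ->
  exists2 S : 'End(V), forall x, f (S x) = S (f x) &
    forall i k, S (iter k f (nth (0, 0%N) L i).1) = iter k f (nth (0, 0%N) L i.+1).1.
Proof.
move=> [hb h0 hs _ _]; set P := map snd L in hs.
pose c j := nth (0%R : V, 0%N) L (reshape_index P j).
pose e := chain_basis f L.
pose img := mkseq (fun j => iter ((c j).2 - (reshape_offset P j).+1) f
  (nth (0%R : V, 0%N) L (reshape_index P j).+1).1) (sumn P).
have [F hF] := linear_of_free e img.
have {}hF : map F e = img.
  by apply: hF; rewrite ?(basis_free hb) // size_mkseq size_chain_basis.
have past i k : ((nth (0%R, 0%N) L i).2 <= k)%N -> iter k f (nth (0%R, 0%N) L i).1 = 0.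
  move=> le; rewrite -(subnK le) iterD; have [li|li] := ltnP i (size L).
    by rewrite h0 ?mem_nth // iter0.
  by rewrite [nth _ _ _]nth_default //= iter0.
have Fchain i k : F (iter k f (nth (0%R, 0%N) L i).1) = iter k f (nth (0%R, 0%N) L i.+1).1.
  have dec : ((nth (0%R : V, 0%N) L i.+1).2 <= (nth (0%R : V, 0%N) L i).2)%N.
    have [li|li] := ltnP i.+1 (size L); last by rewrite [nth _ _ i.+1]nth_default.
    have := nth_sorted_geq hs (leqnSn i); rewrite !(nth_map (0%R, 0%N)) //.
    exact: ltnW.
  have [lk|lk] := leqP (nth (0%R : V, 0%N) L i).2 k.
    by rewrite !past ?linear0 //; apply: leq_trans lk.
  have li : (i < size L)%N by rewrite ltnNge; apply: contraL lk => li; rewrite nth_default.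
  have [j [lj rj oj]] := chain_basis_chain li lk.
  have lje : (j < size e)%N by rewrite size_chain_basis.
  have := congr1 (fun s => s`_j) hF; rewrite (nth_map 0) // nth_mkseq //.
  rewrite nth_chain_basis // /c -/P rj oj subnSK // subKn; last exact: ltnW.
  by [].
exists (linfun F) => [x|i k]; last by rewrite lfunE /= Fchain.
suff E : (f \o linfun F)%VF = (linfun F \o f)%VF.
  by move/lfunP: E => /(_ x); rewrite !comp_lfunE.
apply/(fullv_lfunP _ _ (span_basis hb)) => y /chain_basisP[d dL [k _ ->]].
have [i li <-] := nthP (0%R, 0%N) dL.
by rewrite !comp_lfunE !lfunE /= Fchain -!iterS Fchain.
Qed.

(** The first generator is cyclic for f and the shift of the chains. *)
Lemma cyclic_partner_lfun f : nilpotent_on fullv f ->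
  exists S : 'End(V), exists v, [/\ forall x, f (S x) = S (f x), nilpotent_on fullv S &
    exists s : seq (nat * nat),
      basis_of fullv [seq iter c.1 f (iter c.2 S v) | c <- s]].
Proof.
move=> fn; have [| | | |L hL] := @triangular_chains_exist K V f 0 fullv _ (subvf _).
- by move=> x; rewrite !zero_lfunE linear0.
- exact: subvf.
- exact: fn.
- by exists 1%N => x _; rewrite /= zero_lfunE.
have [S fS hS] := chain_shift hL.
have hS1 i : S (nth (0, 0%N) L i).1 = (nth (0, 0%N) L i.+1).1 by apply: (hS i 0%N).
exists S, (nth (0, 0%N) L 0).1; split=> //.
  apply: (nilpotent_triangular fS (subvf _) (subvf _) fn hL) => i li.
  rewrite hS1; apply: (subvP (addvSr _ _)).
  have [li1|li1] := ltnP i.+1 (size L); last by rewrite nth_default //= mem0v.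
  by apply/memv_span/map_f; rewrite (drop_nth (0%R, 0%N)) // mem_head.
have iterS1 i : iter i S (nth (0, 0%N) L 0).1 = (nth (0, 0%N) L i).1.
  by elim: i => //= i ->.
case: (hL) => hb _ _ _ _; set P := map snd L.
exists (mkseq (fun j => (((nth (0%R : V, 0%N) L (reshape_index P j)).2 - (reshape_offset P j).+1)%N,
   reshape_index P j)) (sumn P)).
rewrite -map_comp (_ : map _ _ = chain_basis f L) //.
apply: (@eq_from_nth _ 0); first by rewrite size_map size_iota size_chain_basis.
move=> j; rewrite size_map size_iota => lj.
by rewrite (nth_map 0%N) ?size_iota // nth_iota //= nth_chain_basis // iterS1.
Qed.

End Chains.

Section MatrixChains.
Variables (K : fieldType) (n : nat).
Implicit Types (A B G : 'M[K]_n.+1).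

Definition lfun_mx A : 'End('cV[K]_n.+1) := linfun (mulmx A).

Lemma lfun_mxE A v : lfun_mx A v = A *m v. Proof. by rewrite lfunE. Qed.

Lemma iter_lfun_mx A k v : iter k (lfun_mx A) v = A ^+ k *m v.
Proof.
elim: k => [|k IH]; first by rewrite mul1mx.
by rewrite iterS IH lfun_mxE exprS mulmxA.
Qed.

Definition mx_lfun (g : 'End('cV[K]_n.+1)) : 'M[K]_n.+1 :=
  \matrix_(i, j) g (delta_mx j 0) i 0.

Lemma mx_lfunE g v : mx_lfun g *m v = g v.
Proof.
rewrite [in RHS](matrix_sum_delta v) linear_sum; apply/matrixP => i k.
rewrite ord1 summxE !mxE; apply: eq_bigr => j _; rewrite big_ord1 linearZ !mxE.
by rewrite mulrC.
Qed.

Lemma mulmx_col_inj A A' : (forall v : 'cV[K]_n.+1, A *m v = A' *m v) -> A = A'.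
Proof.
move=> h; apply/matrixP => i j; have := congr1 (fun u : 'cV_n.+1 => u i 0) (h (delta_mx j 0)).
by rewrite -!colE !mxE.
Qed.

Lemma nilpotent_lfun_mx A : nilpotent_mx A <-> nilpotent_on fullv (lfun_mx A).
Proof.
split=> -[k hk]; exists k; first by move=> x _; rewrite iter_lfun_mx hk mul0mx.
by apply: mulmx_col_inj => v; rewrite -iter_lfun_mx hk ?memvf // mul0mx.
Qed.

Lemma commuting_lfun_mx A B : A * B = B * A ->
  forall x, lfun_mx B (lfun_mx A x) = lfun_mx A (lfun_mx B x).
Proof. by move=> AB x; rewrite !lfun_mxE !mulmxA -[B *m A]AB. Qed.

Lemma jordan_type_mx A P i : has_jordan_type {:'cV[K]_n.+1}%VS (fun v => A *m v) P ->
  \dim (limg (lfun_mx (A ^+ i))) = jordan_rank P i.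
Proof.
apply: jordan_type_rank; first by rewrite mulmx0.
move=> x; rewrite lfun_mxE -iter_lfun_mx; apply: eq_iter => y; exact: lfun_mxE.
Qed.

Lemma has_jordan_type_mx A : nilpotent_mx A ->
  exists P, has_jordan_type {:'cV[K]_n.+1}%VS (fun v => A *m v) P.
Proof.
move/nilpotent_lfun_mx => /(has_jordan_type_exists (subvf _))[P /has_jordan_typeP[h1 [e he hf]]].
exists P; apply/has_jordan_typeP; split=> //; exists e => // j lj.
by rewrite -hf // lfun_mxE.
Qed.

(** G carries a Jordan basis of B that is adapted to A1 to one that is adapted
to A0, and it commutes with B. After conjugation both matrices lie in the linear
space of the matrices that are triangular for the same chains. *)
Lemma conjugate_nilpotent_line A0 A1 B : nilpotent_mx B ->
  nilp_commutator B A0 -> nilp_commutator B A1 ->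
  exists2 G : 'M[K]_n.+1, G \is a GRing.unit &
    forall c0 c1, nilp_commutator B (c0 *: A0 + c1 *: (G * A1 * G^-1)).
Proof.
move=> nB [n0 c0] [n1 c1].
have ex A : nilpotent_mx A -> A * B = B * A -> exists L, triangular_chains (lfun_mx B) (lfun_mx A) fullv L.
  move=> nA AB; apply: triangular_chains_exist; rewrite ?subvf //; try exact/nilpotent_lfun_mx.
  exact: commuting_lfun_mx.
have [L hL] := ex _ n0 c0; have [L' hL'] := ex _ n1 c1.
have jB := has_jordan_type_chains hL; have jB' := has_jordan_type_chains hL'.
have eP : map snd L = map snd L'.
  case: (jB) (jB') => pL _ [pL' _]; apply: (jordan_rank_inj pL pL') => i.
  rewrite -(@jordan_type_rank _ _ _ _ _ i (lfun_mx (B ^+ i)) _ _ jB) ?linear0 //.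
    rewrite (@jordan_type_rank _ _ _ _ _ i (lfun_mx (B ^+ i)) _ _ jB') ?linear0 //.
    by move=> x; rewrite iter_lfun_mx lfun_mxE.
  by move=> x; rewrite iter_lfun_mx lfun_mxE.
have [G [kG fG hG]] := chains_conjugate hL hL' eP.
pose M := mx_lfun G; pose N := mx_lfun (G^-1)%VF.
have NM : N *m M = 1%:M.
  apply: mulmx_col_inj => v; rewrite mul1mx -mulmxA !mx_lfunE lker0_lfunK //.
  exact/eqP.
have uM : M \is a GRing.unit by case: (mulmx1_unit NM).
have MB : M * B = B * M.
  apply: mulmx_col_inj => v; rewrite -!mulmxA !mx_lfunE -!lfun_mxE; exact: esym (fG v).
have VB : M^-1 * B = B * M^-1.
  by apply: (mulrI uM); rewrite mulVKr // mulrA MB mulrK.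
exists M => // a0 a1; set A := _ + _.
have AB : A * B = B * A.
  rewrite mulrDl mulrDr -!scalerAl -!scalerAr c0 -!mulrA VB !mulrA; congr (_ + _ *: _).
  by rewrite -[M * A1 * B]mulrA c1 mulrA MB.
split=> //; apply/nilpotent_lfun_mx.
apply: (nilpotent_triangular (commuting_lfun_mx AB) (subvf _) (subvf _) _ hL).
  exact/nilpotent_lfun_mx.
move=> i li.
have h1 : lfun_mx A0 (nth (0, 0%N) L i).1 \in
    (lfun_mx B @: fullv + <<map fst (drop i.+1 L)>>)%VS by case: hL => _ _ _ _; apply.
have li' : (i < size L')%N by rewrite -(size_map snd) -eP size_map.
have h2 : lfun_mx (M * A1 * M^-1) (nth (0, 0%N) L i).1 \in
    (lfun_mx B @: fullv + <<map fst (drop i.+1 L)>>)%VS.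
  have -> : lfun_mx (M * A1 * M^-1) (nth (0, 0%N) L i).1
     = G (lfun_mx A1 (nth (0, 0%N) L' i).1).
    rewrite !lfun_mxE -hG -(mx_lfunE G (nth _ _ _).1) -/M !mulmxA.
    by rewrite [X in X *m _](_ : _ = M * A1) ?[_ *m M]mulrVK // -mx_lfunE -/M mulmxA.
  have : lfun_mx A1 (nth (0, 0%N) L' i).1 \in
    (lfun_mx B @: fullv + <<map fst (drop i.+1 L')>>)%VS by case: hL' => _ _ _ _; apply.
  case/memv_addP => _ /memv_imgP[y _ ->] [z hz ->]; rewrite linearD memv_add //.
    by rewrite /= -fG memv_img ?memvf.
  have := memv_img G hz; rewrite limg_span; apply: subvP; apply: sub_span.
  move=> _ /mapP[_ /mapP[d dL ->] ->].
  case/(nthP (0%R, 0%N)): dL => m lm <-; rewrite size_drop in lm; rewrite nth_drop hG; apply/mapP.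
  exists (nth (0, 0%N) (drop i.+1 L) m); last by rewrite nth_drop.
  by rewrite mem_nth // size_drop -(size_map snd) eP size_map.
by rewrite lfun_mxE mulmxDl -!scalemxAl memvD // memvZ // -lfun_mxE.
Qed.

End MatrixChains.

(** * Polynomial functions of a matrix *)

Section PolynomialFunctions.
Variables (K : fieldType) (n : nat).
Implicit Types (A D : 'M[K]_n.+1) (q : 'M[K]_n.+1 -> K).

(** The functions on matrices whose nonvanishing loci generate the Zariski
topology. *)
Definition polynomial_function q : Prop :=
  exists p : {mpoly K[(n.+1 * n.+1)%N]},
    forall A, p.@[fun k => mxvec A 0 k] = q A.

Lemma polyfun_ext q q' : q =1 q' -> polynomial_function q -> polynomial_function q'.
Proof. by move=> e [p hp]; exists p => A; rewrite hp e. Qed.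

Lemma polyfun_const c : polynomial_function (fun=> c).
Proof. by exists c%:MP => A; rewrite mevalC. Qed.

Lemma polyfun_entry i j : polynomial_function (fun A => A i j).
Proof. by exists 'X_(mxvec_index i j) => A; rewrite mevalXU mxvecE. Qed.

Lemma polyfun_add q q' : polynomial_function q -> polynomial_function q' ->
  polynomial_function (fun A => q A + q' A).
Proof. by move=> [p hp] [p' hp']; exists (p + p') => A; rewrite mevalD hp hp'. Qed.

Lemma polyfun_mul q q' : polynomial_function q -> polynomial_function q' ->
  polynomial_function (fun A => q A * q' A).
Proof. by move=> [p hp] [p' hp']; exists (p * p') => A; rewrite mevalM hp hp'. Qed.

Lemma polyfun_sum (I : Type) (s : seq I) (F : I -> 'M[K]_n.+1 -> K) :
  (forall i, polynomial_function (F i)) ->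
  polynomial_function (fun A => \sum_(i <- s) F i A).
Proof.
move=> hF; elim: s => [|i s IH].
  by apply: polyfun_ext (polyfun_const 0) => A; rewrite big_nil.
by apply: polyfun_ext (polyfun_add (hF i) IH) => A; rewrite big_cons.
Qed.

Lemma polyfun_prod (I : Type) (s : seq I) (F : I -> 'M[K]_n.+1 -> K) :
  (forall i, polynomial_function (F i)) ->
  polynomial_function (fun A => \prod_(i <- s) F i A).
Proof.
move=> hF; elim: s => [|i s IH].
  by apply: polyfun_ext (polyfun_const 1) => A; rewrite big_nil.
by apply: polyfun_ext (polyfun_mul (hF i) IH) => A; rewrite big_cons.
Qed.

Definition polynomial_matrix a b (M : 'M[K]_n.+1 -> 'M[K]_(a, b)) : Prop :=
  forall i j, polynomial_function (fun A => M A i j).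

Lemma polymx_const a b (C : 'M[K]_(a, b)) : polynomial_matrix (fun=> C).
Proof. by move=> i j; apply: polyfun_const. Qed.

Lemma polymx_id : polynomial_matrix id.
Proof. exact: polyfun_entry. Qed.

Lemma polymx_mul a b c (M : 'M[K]_n.+1 -> 'M[K]_(a, b)) (N : 'M[K]_n.+1 -> 'M[K]_(b, c)) :
  polynomial_matrix M -> polynomial_matrix N -> polynomial_matrix (fun A => M A *m N A).
Proof.
move=> hM hN i j; apply: polyfun_ext (polyfun_sum (index_enum _) (F := fun k A => M A i k * N A k j) _).
  by move=> A; rewrite mxE.
by move=> k; apply: polyfun_mul.
Qed.

Lemma polymx_pow k : polynomial_matrix (fun A => A ^+ k).
Proof.
elim: k => [|k IH]; first exact: polymx_const.
move=> i j; apply: polyfun_ext (polymx_mul polymx_id IH i j) => A.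
by rewrite exprS.
Qed.

Lemma polyfun_det a (M : 'M[K]_n.+1 -> 'M[K]_a) :
  polynomial_matrix M -> polynomial_function (fun A => \det (M A)).
Proof.
move=> hM; apply: polyfun_sum => s; apply: polyfun_mul; first exact: polyfun_const.
by apply: polyfun_prod => i; apply: hM.
Qed.

Lemma polyfun_line q A D : polynomial_function q ->
  exists p : {poly K}, forall t, p.[t] = q (A + t *: D).
Proof.
move=> [p hp].
exists (\sum_(m <- msupp p) (p@_m)%:P *
   \prod_i ((mxvec A 0 i)%:P + (mxvec D 0 i)%:P * 'X) ^+ m i) => t.
rewrite -hp mevalE horner_sum; apply: eq_bigr => m _.
rewrite hornerM hornerC horner_prod; congr (_ * _); apply: eq_bigr => i _.
by rewrite horner_exp !hornerE linearD linearZ !mxE /= mulrC.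
Qed.

Lemma generically_polyfun q A D t0 : polynomial_function q ->
  q (A + t0 *: D) != 0 -> generically (fun t => q (A + t *: D) != 0).
Proof.
move=> /(polyfun_line A D)[p hp] h; exists p => [|l]; last by rewrite hp.
by apply: contraNneq h => p0; rewrite -hp p0 horner0.
Qed.

End PolynomialFunctions.

(** * Cyclic pairs and the dimension of K[A,B] *)

(** A basis of the span inside the family itself, so that it still consists of
monomials in the application. *)
Lemma free_subfamily (K : fieldType) (V : vectType K) (I : eqType) (m : I -> V) (s : seq I) :
  exists s', [/\ {subset s' <= s}, free (map m s') & <<map m s'>>%VS = <<map m s>>%VS].
Proof.
elim: s => [|i s [s' [sub fr e]]]; first by exists [::]; rewrite nil_free.
have [mi|mi] := boolP (m i \in <<map m s>>%VS).
  exists s'; split=> //; first by move=> x /sub xs; rewrite inE xs orbT.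
  by rewrite e /= span_cons; apply/esym/addv_idPr; rewrite -memvE.
exists (i :: s'); split.
- by move=> x; rewrite !inE => /orP[->//|/sub->]; rewrite orbT.
- by rewrite /= free_cons e mi.
- by rewrite /= !span_cons e.
Qed.

Section Gerstenhaber.
Variables (K : fieldType) (n : nat).
Implicit Types (A B X : 'M[K]_n.+1).

Lemma gen_alg_sub A B (U : {vspace 'M[K]_n.+1}) : A * B = B * A ->
  (forall a b, A ^+ a * B ^+ b \in U) -> (gen_alg A B <= U)%VS.
Proof.
move=> AB hU; apply/subv_sumP => i _; rewrite -(limg_form AB).
apply/subvP => _ /memv_imgP[v _ ->]; rewrite form_linE.
by apply: memv_suml => k _; apply: memvZ.
Qed.

Lemma memv_gen_monomial A B a b : A ^+ a * B ^+ b \in gen_alg A B.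
Proof.
have memX X : X \in gen_alg A B -> forall k, X ^+ k \in gen_alg A B.
  move=> hX; elim=> [|k IH]; first by rewrite (subvP (sub1_agenv _)) // memv_line.
  by rewrite exprS; apply: memvM.
by apply: memvM; apply: memX; rewrite ?memv_A ?memv_B.
Qed.

(** Its columns are n+1 monomials in A and B applied to v, so that a nonzero
determinant says that v is a cyclic vector. *)
Definition krylov_mx A B (v : 'cV[K]_n.+1) (s : 'I_n.+1 -> nat * nat) : 'M[K]_n.+1 :=
  \matrix_(i, j) ((A ^+ (s j).1 * B ^+ (s j).2) *m v) i 0.

Lemma krylov_mx_separating A B v s (w : 'rV[K]_n.+1) : \det (krylov_mx A B v s) != 0 ->
  (forall a b, w *m (A ^+ a * B ^+ b) *m v = 0) -> w = 0.
Proof.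
move=> d0 hw; have wk : w *m krylov_mx A B v s = 0.
  apply/rowP => j; have := congr1 (fun u : 'M_1 => u 0 0) (hw (s j).1 (s j).2).
  rewrite -mulmxA !mxE => e; rewrite -[RHS]e; apply: eq_bigr => i _.
  by rewrite !mxE.
apply/eqP; apply: contraNT d0 => w0; apply/det0P; by exists w.
Qed.

Section Cyclic.
Variables (A B : 'M[K]_n.+1) (v : 'cV[K]_n.+1) (s : 'I_n.+1 -> nat * nat).
Hypothesis AB : A * B = B * A.
Hypothesis cyc : \det (krylov_mx A B v s) != 0.

Let ev : 'Hom('M[K]_n.+1, 'cV[K]_n.+1) := linfun (mulmxr v).

Lemma cyclic_ev_inj : (gen_alg A B :&: lker ev = 0)%VS.
Proof.
apply/eqP; rewrite -subv0; apply/subvP => x /memv_capP[xG].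
rewrite memv_ker lfunE /= => /eqP xv; rewrite memv0; apply/eqP/row_matrixP => i.
rewrite row0; apply: (krylov_mx_separating cyc) => a b.
rewrite -row_mul -row_mul [x *m _](gen_algC AB xG (memv_gen_monomial _ _ _ _)).
by rewrite -[_ *m x *m v]mulmxA xv mulmx0 row0.
Qed.

Lemma cyclic_ev_onto : (ev @: gen_alg A B = fullv)%VS.
Proof.
apply/eqP; rewrite eqEsubv subvf /=; apply/subvP => u _.
have uk : krylov_mx A B v s \in unitmx by rewrite unitmxE unitfE.
apply/memv_imgP; exists (\sum_j (invmx (krylov_mx A B v s) *m u) j 0 *:
   (A ^+ (s j).1 * B ^+ (s j).2)).
  by apply: memv_suml => j _; apply/memvZ/memv_gen_monomial.
rewrite lfunE /= mulmx_suml -{1}[u](mulKVmx uk); apply/colP => i.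
rewrite summxE mxE; apply: eq_bigr => j _.
by rewrite -scalemxAl [in RHS]mxE [krylov_mx _ _ _ _ i j]mxE mulrC.
Qed.

Lemma cyclic_dim : \dim (gen_alg A B) = n.+1.
Proof.
by rewrite -(limg_dim_eq cyclic_ev_inj) cyclic_ev_onto dimvf dim_matrix mulr1.
Qed.

(** Evaluation at the cyclic vector is an isomorphism of K[A,B]-modules from
K[A,B] to the column space. *)
Lemma cyclic_amull_rank X : X \in gen_alg A B ->
  \dim (amull X @: gen_alg A B) = \dim (limg (lfun_mx X)).
Proof.
move=> XG; have sub : (amull X @: gen_alg A B <= gen_alg A B)%VS.
  by apply/subvP => _ /memv_imgP[y yG ->]; rewrite lfunE /= memvM.
rewrite -(@limg_dim_eq _ _ _ ev); last first.
  by apply/eqP; rewrite -subv0 -cyclic_ev_inj capvS.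
rewrite -cyclic_ev_onto -!limg_comp; congr (\dim _).
by apply: eq_in_limg => y _; rewrite !comp_lfunE !lfunE /= mulmxA.
Qed.

End Cyclic.

(** The set of the A with a nonzero determinant is open, and S shows that it
is not empty. *)
Lemma cyclic_partner B : nilpotent_mx B ->
  exists S v s, nilp_commutator B S /\ \det (krylov_mx S B v s) != 0.
Proof.
move=> /nilpotent_lfun_mx /cyclic_partner_lfun[S [v [BS nS [s hs]]]].
have ss : size s = n.+1.
  by rewrite -(size_map (fun c => iter c.1 (lfun_mx B) (iter c.2 S v)))
    -(size_basis (X := in_tuple _) hs) dimvf dim_matrix mulr1.
have SE k u : iter k S u = mx_lfun S ^+ k *m u.
  elim: k u => [|k IH] u; first by rewrite mul1mx.
  by rewrite iterS IH -mx_lfunE exprS mulmxA.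
have SB : mx_lfun S * B = B * mx_lfun S.
  by apply: mulmx_col_inj => u; rewrite -!mulmxA !mx_lfunE -!lfun_mxE BS.
exists (mx_lfun S), v, (fun j => let c := nth (0%N, 0%N) s j in (c.2, c.1)); split.
  split=> //; have [k hk] := nS; exists k; apply: mulmx_col_inj => u.
  by rewrite -SE hk ?memvf // mul0mx.
apply/det0P => -[w w0 wk]; case/eqP: w0.
have wx x : x \in [seq iter c.1 (lfun_mx B) (iter c.2 S v) | c <- s] -> w *m x = 0.
  case/(nthP 0) => j; rewrite size_map => lj <-; rewrite (nth_map (0%N, 0%N)) //.
  have lj' : (j < n.+1)%N by rewrite -ss.
  apply/rowP => i; rewrite ord1 iter_lfun_mx SE [B ^+ _ *m (_ *m _)]mulmxA.
  rewrite [B ^+ _ *m _ ^+ _](commrX _ (commr_sym (commrX _ SB))).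
  have := congr1 (fun u : 'rV_n.+1 => u 0 (Ordinal lj')) wk; rewrite !mxE => e.
  by rewrite -[RHS]e; apply: eq_bigr => k _; rewrite !mxE.
have wf : linfun (mulmx w) = 0 :> 'Hom('cV[K]_n.+1, 'M[K]_1).
  by apply/(fullv_lfunP _ _ (span_basis hs)) => x /wx e; rewrite lfunE zero_lfunE.
apply/rowP => j; have := congr1 (fun f : 'Hom('cV[K]_n.+1, 'M[K]_1) => f (delta_mx j 0) 0 0) wf.
by rewrite lfunE /= zero_lfunE -colE !mxE.
Qed.

Lemma polymx_krylov B v s : polynomial_matrix (fun A => krylov_mx A B v s).
Proof.
move=> i j; have := polymx_mul (polymx_mul (@polymx_pow K n (s j).1)
  (@polymx_const K n _ _ (B ^+ (s j).2))) (@polymx_const K n _ _ v) i 0.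
by apply: polyfun_ext => A; rewrite [in RHS]mxE.
Qed.

(** Gerstenhaber's theorem for pairs with one nilpotent member. Move A along the
line to a matrix S that is cyclic with B: monomials that are linearly independent
at A remain so for a generic point of the line, where the pair is cyclic and
generates an algebra of dimension n+1. *)
Lemma gerstenhaber A B : GRing.closed_field_axiom K -> A * B = B * A -> nilpotent_mx B ->
  (\dim (gen_alg A B) <= n.+1)%N.
Proof.
move=> clK AB nB; have [S [v [s [[_ SB] cyc]]]] := cyclic_partner nB.
pose mon X (c : nat * nat) : 'M[K]_n.+1 := X ^+ c.1 * B ^+ c.2.
pose G := gen_alg A B.
pose all_mon := [seq (a, b) | a <- iota 0 (dim 'M[K]_n.+1), b <- iota 0 (dim 'M[K]_n.+1)].
have spanG : G = <<map (mon A) all_mon>>%VS.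
  apply/eqP; rewrite eqEsubv; apply/andP; split; last first.
    by apply/span_subvP => _ /mapP[c _ ->]; apply: memv_gen_monomial.
  apply/subv_sumP => i _; rewrite -(limg_form AB).
  apply/subvP => _ /memv_imgP[u _ ->]; rewrite form_linE.
  apply: memv_suml => k _; apply/memvZ/memv_span/mapP; exists (nat_of_ord k, (i - k)%N) => //.
  have il : (i < dim 'M[K]_n.+1)%N by rewrite -dimvf ltn_ord.
  rewrite allpairs_f // mem_iota /= add0n.
    by apply: leq_ltn_trans il; rewrite -ltnS.
  exact: leq_ltn_trans (leq_subr _ _) il.
have [t [_ frt spt]] := free_subfamily (mon A) all_mon.
have szt : size t = \dim G by rewrite spanG -spt (eqP frt) size_map.
pose r := size t; pose c k := nth (0%N, 0%N) t k.
pose F X : 'M[K]_(r, (n.+1 * n.+1)%N) := \matrix_(k, l) mxvec (mon X (c k)) 0 l.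
pose T X := map_tuple (mon X) (in_tuple t).
have mulF X w : w *m F X = mxvec (\sum_k w 0 k *: (T X)`_k).
  apply/rowP => l; rewrite linear_sum summxE mxE; apply: eq_bigr => k _.
  by rewrite linearZ !mxE (nth_map (0%N, 0%N)).
have fam_free X : row_free (F X) -> free (T X).
  move=> rF; apply/freeP => k k0 i.
  have : (\row_j k j) *m F X = 0.
    by rewrite mulF -[RHS](linear0 mxvec) -[in RHS]k0; congr mxvec; apply: eq_bigr => j _; rewrite mxE.
  move/eqP; rewrite mulmx_free_eq0 // => /eqP/rowP/(_ i).
  by rewrite !mxE.
have freeF : row_free (F A).
  apply: inj_row_free => w; rewrite mulF => /eqP; rewrite mxvec_eq0 => /eqP w0.
  have frT : free (T A) by [].
  by apply/rowP => i; rewrite mxE; move/freeP: frT => /(_ _ w0).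
have [C FC] : exists C, F A *m C = 1%:M by apply/row_freeP.
have PF : polynomial_matrix F.
  move=> k l; case/mxvec_indexP: l => i j.
  have := polymx_mul (@polymx_pow K n (c k).1) (@polymx_const K n _ _ (B ^+ (c k).2)) i j.
  by apply: polyfun_ext => X; rewrite [in RHS]mxE mxvecE.
(* q1 is nonzero at A, where t = 0, and q2 is nonzero at S, where t = 1 *)
pose q1 X := \det (F X *m C); pose q2 X := \det (krylov_mx X B v s).
have Pq1 : polynomial_function q1 by apply/polyfun_det/polymx_mul => //; apply: polymx_const.
have Pq2 : polynomial_function q2 by apply/polyfun_det/polymx_krylov.
have g1 := @generically_polyfun _ _ q1 A (S - A) 0 Pq1.
have g2 := @generically_polyfun _ _ q2 A (S - A) 1 Pq2.
rewrite scale0r addr0 /q1 FC det1 oner_neq0 in g1.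
rewrite scale1r addrC subrK /q2 in g2.
have [l [h1 h2]] := generically_ex clK (generically_and (g1 isT) (g2 cyc)).
set X := A + l *: (S - A) in h1 h2.
have XB : X * B = B * X.
  by rewrite /X mulrDl mulrDr -scalerAl -scalerAr mulrBl mulrBr AB SB.
have freeX : row_free (F X).
  apply: inj_row_free => w w0; apply/eqP; apply: contraNT h1 => wn; apply/det0P.
  by exists w => //; rewrite mulmxA w0 mul0mx.
rewrite -/G -szt -(cyclic_dim XB h2) -(size_map (mon X) t) -(eqP (fam_free _ freeX)).
by apply/dimvS/span_subvP => _ /mapP[d _ ->]; apply: memv_gen_monomial.
Qed.

End Gerstenhaber.

Section RankBound.
Variables (K : fieldType) (n : nat).
Implicit Types (A B X : 'M[K]_n.+1).

(** X factors as L R through a space of dimension rank X, on which A and B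
induce commuting operators A1 and B1. Then X K[A,B] = L K[A1,B1] R, and the
dimension of K[A1,B1] is bounded by Gerstenhaber's theorem. *)
Lemma amull_rank_le A B X : GRing.closed_field_axiom K -> A * B = B * A ->
  nilpotent_mx B -> X \in gen_alg A B ->
  (\dim (amull X @: gen_alg A B) <= \rank X)%N.
Proof.
move=> clK AB [b0 B0] XG.
have XA : A * X = X * A by apply: (gen_algC AB) => //; apply: memv_A.
have XB : B * X = X * B by apply: (gen_algC AB) => //; apply: memv_B.
have [L' L'L] : exists L', L' *m col_base X = 1%:M by apply/row_fullP/col_base_full.
have [R' RR'] : exists R', row_base X *m R' = 1%:M by apply/row_freeP/row_base_free.
move: (col_base X) (row_base X) L'L RR' (mulmx_base X).
move: (\rank X) L' R' => [|m] L' R' L R L'L RR' XLR.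
  rewrite -XLR (flatmx0 R) mulmx0 leqn0 dimv_eq0 -subv0; apply/subvP => _ /memv_imgP[y _ ->].
  by rewrite lfunE /= mul0r mem0v.
pose A1 : 'M[K]_m.+1 := R *m A *m R'; pose B1 : 'M[K]_m.+1 := R *m B *m R'.
have push C : C * X = X * C -> C *m L = L *m (R *m C *m R').
  move=> CX; rewrite !mulmxA XLR -[X *m C]CX -XLR.
  by rewrite -!mulmxA RR' mulmx1.
have Linj p (Y Z : 'M[K]_(m.+1, p)) : L *m Y = L *m Z -> Y = Z.
  by move=> e; rewrite -[Y]mul1mx -L'L -mulmxA e mulmxA L'L mul1mx.
have pushA : A *m L = L *m A1 := push A XA.
have pushB : B *m L = L *m B1 := push B XB.
clearbody A1 B1.
have powA k : A ^+ k *m L = L *m A1 ^+ k.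
  elim: k => [|k IH]; first by rewrite mul1mx mulmx1.
  by rewrite exprSr -mulmxA pushA mulmxA IH -mulmxA exprSr.
have powB k : B ^+ k *m L = L *m B1 ^+ k.
  elim: k => [|k IH]; first by rewrite mul1mx mulmx1.
  by rewrite exprSr -mulmxA pushB mulmxA IH -mulmxA exprSr.
have AB1 : A1 * B1 = B1 * A1.
  apply: Linj; rewrite -[A1 * B1]/(A1 *m B1) -[B1 * A1]/(B1 *m A1) !mulmxA.
  by rewrite -pushA -pushB -!mulmxA -pushA -pushB !mulmxA [A *m B]AB.
have nB1 : nilpotent_mx B1.
  by exists b0; apply: Linj; rewrite -powB B0 mul0mx mulmx0.
apply: leq_trans (gerstenhaber clK AB1 nB1).
pose Psi : 'Hom('M[K]_m.+1, 'M[K]_n.+1) := linfun (mulmx L \o mulmxr R).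
apply: leq_trans (_ : \dim (Psi @: gen_alg A1 B1) <= _)%N; last first.
  by rewrite -[X in (_ <= X)%N](limg_ker_dim Psi) leq_addl.
apply: dimvS.
suff : (gen_alg A B <= amull X @^-1: (Psi @: gen_alg A1 B1))%VS.
  by move=> /subvP sub; apply/subvP => _ /memv_imgP[y /sub hy ->]; rewrite memv_preim.
apply: gen_alg_sub => // a b; rewrite -memv_preim lfunE /=.
have -> : X * (A ^+ a * B ^+ b) = Psi (A1 ^+ a * B1 ^+ b).
  rewrite (gen_algC AB XG (memv_gen_monomial _ _ _ _)) lfunE /= -[in LHS]XLR.
  change (A ^+ a *m B ^+ b *m (L *m R) = L *m (A1 ^+ a *m B1 ^+ b *m R)).
  by rewrite [LHS]mulmxA -[_ *m L]mulmxA powB [_ *m (L *m _)]mulmxA powA -!mulmxA.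
exact/memv_img/memv_gen_monomial.
Qed.

Lemma dim_limg_lfun_mx X : \dim (limg (lfun_mx X)) = \rank X.
Proof.
have [L' L'L] : exists L', L' *m col_base X = 1%:M by apply/row_fullP/col_base_full.
have [R' RR'] : exists R', row_base X *m R' = 1%:M by apply/row_freeP/row_base_free.
pose f : 'Hom('cV[K]_n.+1, 'cV[K]_(\rank X)) := linfun (mulmx (row_base X)).
pose g : 'Hom('cV[K]_(\rank X), 'cV[K]_n.+1) := linfun (mulmx (col_base X)).
have -> : lfun_mx X = (g \o f)%VF.
  by apply/lfunP => v; rewrite comp_lfunE !lfunE /= mulmxA mulmx_base.
have f_onto : limg f = fullv.
  apply/eqP; rewrite eqEsubv subvf; apply/subvP => v _; apply/memv_imgP.
  by exists (R' *m v); rewrite ?memvf // lfunE /= mulmxA RR' mul1mx.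
rewrite limg_comp f_onto limg_dim_eq ?dimvf ?dim_matrix ?mulr1 //.
apply/eqP; rewrite -subv0; apply/subvP => v /memv_capP[_].
rewrite memv_ker lfunE /= memv0 => /eqP e.
by rewrite -[v]mul1mx -L'L -mulmxA e mulmx0.
Qed.

(** Together with [minor_rank]: lower bounds on the rank are open conditions. *)
Lemma rank_minor X : exists (C : 'M[K]_(\rank X, n.+1)) (D : 'M[K]_(n.+1, \rank X)),
  \det (C *m X *m D) != 0.
Proof.
have [L' L'L] : exists L', L' *m col_base X = 1%:M by apply/row_fullP/col_base_full.
have [R' RR'] : exists R', row_base X *m R' = 1%:M by apply/row_freeP/row_base_free.
exists L', R'; have -> : L' *m X = row_base X.
  by rewrite -[X in L' *m X = _]mulmx_base mulmxA L'L mul1mx.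
by rewrite RR' det1 oner_neq0.
Qed.

Lemma minor_rank r X (C : 'M[K]_(r, n.+1)) (D : 'M[K]_(n.+1, r)) :
  \det (C *m X *m D) != 0 -> (r <= \rank X)%N.
Proof.
move=> d0; have : row_free (C *m X *m D).
  by rewrite row_free_unit unitmxE unitfE.
rewrite /row_free => /eqP {1}<-.
exact: leq_trans (mxrankM_maxl _ _) (mxrankM_maxr _ _).
Qed.

End RankBound.

(** * The generic Jordan type of the nilpotent commutator *)

Lemma exists_maximum (T : Type) (Q : T -> Prop) (phi : T -> nat) (b : nat) :
  (exists x, Q x) -> (forall x, Q x -> (phi x <= b)%N) ->
  exists2 x, Q x & forall y, Q y -> (phi y <= phi x)%N.
Proof.
move=> [x0 Qx0] hb.
suff H m x : Q x -> (b - phi x <= m)%N -> exists2 x, Q x & forall y, Q y -> (phi y <= phi x)%N.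
  exact: (H b x0 Qx0 (leq_subr _ _)).
elim: m x => [|m IH] x Qx hm.
  by exists x => // y /hb; lia.
case: (classic (exists2 y, Q y & (phi x < phi y)%N)) => [[y Qy lt]|no].
  by apply: (IH y Qy); lia.
exists x => // y Qy; rewrite leqNgt; apply/negP => lt; apply: no; by exists y.
Qed.

Section JordanNilp.
Variables (K : fieldType) (n : nat).

Lemma jordan_nilp_nilpotent P : nilpotent_mx (jordan_nilp K n.+1 P).
Proof.
set B := jordan_nilp K n.+1 P.
have H k (i j : 'I_n.+1) : (j != i + k :> nat)%N -> (B ^+ k) i j = 0.
  elim: k i => [|k IH] i; first by rewrite addn0 mxE eq_sym -val_eqE => /negbTE /= ->.
  move=> ne; rewrite exprS mxE big1 // => l _; rewrite mxE.
  have [e|] := eqVneq (l : nat) i.+1; last by rewrite mul0r.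
  by rewrite IH ?mulr0 // e addSnnS.
exists n.+1; apply/matrixP => i j; rewrite H ?mxE //.
by rewrite neq_ltn (leq_trans (ltn_ord j)) // leq_addl.
Qed.

End JordanNilp.

Section Pencil.
Variables (K : fieldType) (n : nat) (A B : 'M[K]_n.+1).
Hypothesis nB : nilpotent_mx B.
Hypothesis hA : nilp_commutator B A.

Lemma nilp_commutator_pencil mu : nilp_commutator B (A - mu *: B).
Proof.
case: hA => nA AB; split; last by rewrite mulrBl mulrBr -scalerAl -scalerAr AB.
have [m Jm] := max_ideal_nilpotent AB nA nB; exists m; apply/eqP.
by rewrite -memv0 -Jm; apply: pencilX_max_ideal.
Qed.

Lemma pencilX_gen mu i : (A - mu *: B) ^+ i \in gen_alg A B.
Proof.
case: hA => nA AB; rewrite -(max_ideal_pow0 AB).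
by apply: (subvP (max_ideal_pow_le AB (leq0n i))); apply: pencilX_max_ideal.
Qed.

(** The Jordan type exists because multiplication by the pencil is nilpotent;
the ranks of its powers identify it. *)
Lemma lefschetz_jordan_type mu : \dim (gen_alg A B) = n.+1 -> lefschetz A B mu ->
  has_jordan_type (gen_alg A B) (fun x => (A - mu *: B) * x) (hilbert_partition A B).
Proof.
case: (hA) => nA AB dG lef; set l := A - mu *: B; set G := gen_alg A B.
have itl i x : iter i (fun x => l * x) x = l ^+ i * x.
  by elim: i => [|i IH]; rewrite ?mul1r //= IH exprS mulrA.
have stable : (amull l @: G <= G)%VS.
  apply/subvP => _ /memv_imgP[x xG ->]; rewrite lfunE; apply: memvM => //.
  exact: (pencilX_gen mu 1).
have nil : nilpotent_on G (amull l).
  have [[m lm] _] := nilp_commutator_pencil mu; exists m => x _.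
  rewrite (eq_iter (f' := fun x => l * x)); last by move=> y; rewrite lfunE.
  by rewrite itl lm mul0r.
have [P hP] := has_jordan_type_exists stable nil.
have {}hP : has_jordan_type G (fun x => l * x) P.
  case/has_jordan_typeP: hP => h1 [e h2 h3]; apply/has_jordan_typeP; split=> //.
  by exists e => // j lj; rewrite -h3 // lfunE.
suff <- : P = hilbert_partition A B by [].
apply: (@jordan_rank_inj n.+1); first by case: hP; rewrite dG.
  exact: hilbert_partition_is_partition.
move=> i; rewrite -(lefschetz_jordan_rank AB nA nB dG i lef).
apply: esym; apply: (jordan_type_rank _ _ hP); first by rewrite mulr0.
by move=> x; rewrite itl lfunE.
Qed.

Lemma generic_pencil_jordan_type : \dim (gen_alg A B) = n.+1 ->
  GRing.closed_field_axiom K -> char_zero_or_gt K (socle_degree A B) ->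
  exists s : seq (option K), forall l, l \notin s ->
    has_jordan_type (gen_alg A B) (fun x => pencil A B l * x) (hilbert_partition A B).
Proof.
move=> dG clK hK.
have [s hs] := generically_cofinite clK (generically_lefschetz hK).
(* the point at infinity is put into the finite exceptional set *)
exists (None :: [seq Some (- mu) | mu <- s]) => -[c|] //; rewrite inE /= => hc.
have -> : A + c *: B = A - (- c) *: B by rewrite scaleNr opprK.
apply: lefschetz_jordan_type => //; apply: hs; apply: contra hc => hc.
by apply/mapP; exists (- c); rewrite ?opprK.
Qed.

End Pencil.

Lemma char_zero_or_gtS (K : fieldType) a b :
  (a <= b)%N -> char_zero_or_gt K b -> char_zero_or_gt K a.
Proof.
move=> ab [?|[p cp bp]]; first by left.
by right; exists p => //; apply: leq_ltn_trans bp.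
Qed.

Lemma socle_degree_le (K : fieldType) n (A B : 'M[K]_n.+1) : (socle_degree A B <= n)%N.
Proof. by apply/bigmax_leqP => k _; rewrite -ltnS. Qed.

Section GenericJordanType.
Variables (K : fieldType) (n : nat) (B : 'M[K]_n.+1).
Hypothesis clK : GRing.closed_field_axiom K.
Hypothesis nB : nilpotent_mx B.
Implicit Types (A : 'M[K]_n.+1) (Q : seq nat).

(** A polynomial function that is nonzero at A and vanishes wherever one of the
listed ranks drops. *)
Lemma rank_semicontinuous A (s : seq nat) :
  exists q, [/\ polynomial_function q, q A != 0 &
    forall A', q A' != 0 -> forall i, i \in s -> (\rank (A ^+ i) <= \rank (A' ^+ i))%N].
Proof.
elim: s => [|i s [q [hq qA hs]]].
  by exists (fun=> 1); split; [exact: polyfun_const | exact: oner_neq0|].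
have [C [D d0]] := rank_minor (A ^+ i).
exists (fun X => \det (C *m X ^+ i *m D) * q X); split.
- apply: polyfun_mul => //; apply/polyfun_det/polymx_mul; last exact: polymx_const.
  by apply: polymx_mul; [exact: polymx_const | exact: polymx_pow].
- by rewrite mulf_neq0.
- move=> A'; rewrite mulf_eq0 negb_or => /andP[/minor_rank le /hs hs'] j.
  by rewrite inE => /orP[/eqP->|/hs'].
Qed.

Lemma principal_open q : polynomial_function q ->
  zariski_open_in (nilp_commutator B) (fun A => nilp_commutator B A /\ q A != 0).
Proof.
move=> [p hp]; exists (eq p) => A; split=> -[nA h]; split=> //.
  by exists p => //; rewrite hp.
by case: h => _ <-; rewrite hp.
Qed.

Lemma jordan_type_rank_mx A P i :
  has_jordan_type {:'cV[K]_n.+1}%VS (fun v => A *m v) P ->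
  \rank (A ^+ i) = jordan_rank P i.
Proof. by move/(jordan_type_mx i) <-; rewrite dim_limg_lfun_mx. Qed.

Lemma jordan_rank_large P i : is_partition n.+1 P -> (n < i)%N -> jordan_rank P i = 0%N.
Proof.
case/and3P => _ _ /eqP eP ni; rewrite /jordan_rank big_seq big1 // => p pP.
apply/eqP; rewrite subn_eq0; apply: leq_trans ni; rewrite -eP.
by elim: P pP {eP} => //= x s IH; rewrite inE => /orP[/eqP->|/IH]; lia.
Qed.

Lemma dim_cV : \dim {:'cV[K]_n.+1}%VS = n.+1.
Proof. by rewrite dimvf dim_matrix mulr1. Qed.

(** Take M for which the sum of the ranks of its powers is the largest. Given
A0 in an open set, a line through A0 and a conjugate of M has points in this
open set at which all the ranks are at least those of M; by the choice of M they
are then equal. *)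
Lemma generic_jordan_type_exists : exists Q, generic_jordan_type B Q.
Proof.
have [|A|M hM maxM] := @exists_maximum _ (nilp_commutator B)
  (fun A => \sum_(i < n.+2) \rank (A ^+ i))%N (\sum_(i < n.+2) n.+1)%N.
- by exists 0; split; [exists 1%N | rewrite mul0r mulr0].
- by move=> _; apply: leq_sum => i _; apply: rank_leq_row.
have [Q hQ] := has_jordan_type_mx (proj1 hM).
pose good A := forall i, i \in iota 0 n.+2 -> (\rank (M ^+ i) <= \rank (A ^+ i))%N.
exists Q, (fun A => nilp_commutator B A /\ good A); split.
(* all polynomials whose nonvanishing forces the ranks to be large *)
- exists (fun p => forall A, p.@[fun k => mxvec A 0 k] != 0 -> good A) => A.
  split=> -[hA h]; split=> //; last by case: h => p; apply.
  have [q [[p hp] qA hq]] := rank_semicontinuous A (iota 0 n.+2).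
  exists p; last by rewrite hp.
  by move=> A'; rewrite hp => /hq le i hi; apply: leq_trans (h i hi) (le i hi).
- move=> V [F hF] [A0 VA0].
  have [hA0 [p Fp pA0]] := proj1 (hF A0) VA0.
  have [G uG line] := conjugate_nilpotent_line nB hA0 hM.
  set A1 := G * M * G^-1 in line.
  have powA1 i : A1 ^+ i = G * M ^+ i * G^-1.
    elim: i => [|i IH]; first by rewrite !expr0 mulr1 mulrV.
    by rewrite !exprS IH /A1 !mulrA mulrVK.
  have rankA1 i : (\rank (M ^+ i) <= \rank (A1 ^+ i))%N.
    have -> : M ^+ i = G^-1 *m A1 ^+ i *m G.
      by rewrite powA1 -!mulrA [G^-1 *m _]mulKr // [_ *m G]mulrVK.
    by apply: leq_trans (mxrankM_maxl _ _) (mxrankM_maxr _ _).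
  have [q [hq qA1 hs]] := rank_semicontinuous A1 (iota 0 n.+2).
  have Pp : polynomial_function (fun A => p.@[fun k => mxvec A 0 k]) by exists p.
  have g1 := @generically_polyfun _ _ _ A0 (A1 - A0) 0 Pp.
  have g2 := @generically_polyfun _ _ _ A0 (A1 - A0) 1 hq.
  rewrite scale0r addr0 in g1; rewrite scale1r addrC subrK in g2.
  have [t [h1 h2]] := generically_ex clK (generically_and (g1 pA0) (g2 qA1)).
  set X := A0 + t *: (A1 - A0) in h1 h2.
  have hX : nilp_commutator B X.
    have -> : X = (1 - t) *: A0 + t *: A1; last exact: line.
    by rewrite /X scalerBr scalerBl scale1r addrCA [RHS]addrC.
  exists X; first by apply/hF; split=> //; exists p.
  by split=> // i hi; apply: leq_trans (rankA1 i) (hs _ h2 i hi).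
- move=> A [hA gA].
  have [P hP] := has_jordan_type_mx (proj1 hA).
  suff <- : P = Q by [].
  have pP : is_partition n.+1 P by case: hP; rewrite dim_cV.
  have pQ : is_partition n.+1 Q by case: hQ; rewrite dim_cV.
  apply: (jordan_rank_inj pP pQ) => i.
  have [ni|ni] := ltnP n i; first by rewrite !jordan_rank_large.
  rewrite -(jordan_type_rank_mx _ hP) -(jordan_type_rank_mx _ hQ).
  have iN : (i < n.+2)%N by apply: leqW; rewrite ltnS.
  apply/eqP; rewrite eqn_leq (gA i) ?mem_iota // andbT leqNgt; apply/negP => lt.
  have := maxM A hA; rewrite leqNgt => /negP[].
  rewrite (bigD1 (Ordinal iN)) //= [X in (_ < X)%N](bigD1 (Ordinal iN)) //= -addSn.
  apply: leq_add => //; apply: leq_sum => k _; apply: gA.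
  by rewrite mem_iota ltn_ord.
Qed.

(** Choose A both generic and cyclic. For generic mu the matrix A - mu B is
still generic and is a Lefschetz element of K[A,B]; its Jordan type is Q on the
column space and the dual of the Hilbert function on K[A,B]. *)
Lemma generic_cyclic_jordan_type Q : char_zero_or_gt K n.+1 -> generic_jordan_type B Q ->
  exists2 A, full_dim_locus B A & hilbert_partition A B = Q.
Proof.
move=> hK [U [[F hF] dU tU]].
have [S [v [s [hS cyc]]]] := cyclic_partner nB.
have Pk : polynomial_function (fun A => \det (krylov_mx A B v s)).
  exact/polyfun_det/polymx_krylov.
have [|A [hA cA] UA] := dU _ (principal_open Pk); first by exists S.
have [_ [p Fp pA]] := proj1 (hF A) UA.
have dA : \dim (gen_alg A B) = n.+1 by apply: (cyclic_dim (proj2 hA) cA).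
exists A => //.
have Pp : polynomial_function (fun A => p.@[fun k => mxvec A 0 k]) by exists p.
have g1 := @generically_polyfun _ _ _ A (- B) 0 Pp.
rewrite scale0r addr0 in g1.
have hKA : char_zero_or_gt K (socle_degree A B).
  by apply: char_zero_or_gtS hK; apply: leqW; apply: socle_degree_le.
have [mu [h1 h2]] := generically_ex clK
  (generically_and (g1 pA) (generically_lefschetz hKA)).
rewrite scalerN in h1; set l := A - mu *: B in h1.
have Ul : U l by apply/hF; split; [exact: nilp_commutator_pencil | exists p].
have hl := tU _ Ul.
apply: (@jordan_rank_inj n.+1).
- by apply: hilbert_partition_is_partition; case: (hA).
- by case: hl; rewrite dim_cV.
move=> i; case: (hA) => nA AB.
rewrite -(lefschetz_jordan_rank AB nA nB dA i h2) -/l.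
rewrite (cyclic_amull_rank AB cA); last exact: pencilX_gen.
by rewrite dim_limg_lfun_mx; apply: jordan_type_rank_mx.
Qed.

(** The ranks of the powers of a Lefschetz element l on K[A,B] are at most
those of l as a matrix, which are at most those at nearby generic matrices. *)
Lemma generic_majorizes Q A : char_zero_or_gt K n.+1 -> generic_jordan_type B Q ->
  full_dim_locus B A -> majorizes Q (hilbert_partition A B).
Proof.
move=> hK [U [[F hF] dU tU]] [hA dA].
have hKA : char_zero_or_gt K (socle_degree A B).
  by apply: char_zero_or_gtS hK; apply: leqW; apply: socle_degree_le.
have [mu lef] := generically_ex clK (generically_lefschetz hKA).
set l := A - mu *: B; have hl : nilp_commutator B l by exact: nilp_commutator_pencil.
have near i : exists2 A', U A' & (\rank (l ^+ i) <= \rank (A' ^+ i))%N.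
  have [q [hq ql hs]] := rank_semicontinuous l [:: i].
  have [|A' [hA' qA'] UA'] := dU _ (principal_open hq); first by exists l.
  by exists A' => //; apply: (hs _ qA'); rewrite mem_head.
have [A' UA' _] := near 0%N.
apply: majorizes_of_jordan_rank; first by case: (tU _ UA') => /and3P[].
move=> i; case: (hA) => nA AB.
rewrite -(lefschetz_jordan_rank AB nA nB dA i lef) -/l.
have lG : l ^+ i \in gen_alg A B by apply: pencilX_gen.
apply: leq_trans (amull_rank_le clK AB nB lG) _.
have [A'' UA'' le] := near i.
by apply: leq_trans le _; rewrite (jordan_type_rank_mx i (tU _ UA'')).
Qed.

End GenericJordanType.

Theorem theorem2 (K : fieldType) (n : nat) (P : seq nat)
    (hP : is_partition n.+1 P) :
  let B : 'M[K]_n.+1 := jordan_nilp K n.+1 P in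
  (forall A : 'M[K]_n.+1,
     full_dim_locus B A ->
     GRing.closed_field_axiom K ->
     char_zero_or_gt K (socle_degree A B) ->
     exists s : seq (option K), forall l : option K, l \notin s ->
       has_jordan_type (gen_alg A B) (fun x => pencil A B l * x)
         (hilbert_partition A B))
  /\
  (GRing.closed_field_axiom K ->
   char_zero_or_gt K n.+1 ->
   (exists Q : seq nat, generic_jordan_type B Q) /\
   forall Q : seq nat, generic_jordan_type B Q ->
     [/\ exists2 A : 'M[K]_n.+1, full_dim_locus B A & hilbert_partition A B = Q,
         forall A : 'M[K]_n.+1, full_dim_locus B A ->
           majorizes Q (hilbert_partition A B)
       & strictly_decreasing Q]).
Proof.
move=> B; have nB : nilpotent_mx B by exact: jordan_nilp_nilpotent.
split=> [A [hA dA] clK hK|clK hK].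
  exact: generic_pencil_jordan_type.
split=> [|Q hQ]; first exact: generic_jordan_type_exists.
have [A [hA dA] eQ] := generic_cyclic_jordan_type clK nB hK hQ.
split; first by exists A.
  by move=> A' hA'; apply: generic_majorizes.
rewrite -eQ; case: (hA) => nA AB; exact: hilbert_partition_strict.
Qed.
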